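(* Let $d\ge2$, let $Y$ be a closed parallelepiped of $\mathbb{R}^d$, and let $u\in C^3(\mathbb{R}^d)$ be such that $\nabla u$ is $Y$-periodic, $\langle\nabla u\rangle\neq0$, and $\nabla u\neq0$ everywhere in $\mathbb{R}^d$. Then the gradient field $\nabla u$ is an isotropically realizable electric field in $\mathbb{R}^d$.
   Context: $\langle\cdot\rangle$ denotes the average over $Y$. For $u\in C^1(\mathbb{R}^d)$, the field $\nabla u$ is an isotropically realizable electric field in $\mathbb{R}^d$ if there exists a positive scalar function $\sigma\in L^\infty_{\rm loc}(\mathbb{R}^d)$ (not required to be periodic) such that $\operatorname{div}(\sigma\nabla u)=0$ in the sense of distributions on $\mathbb{R}^d$. *)

(* Defs.v *)
From HB Require Import structures.
From mathcomp Require Import all_boot all_order all_algebra.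
From mathcomp Require Import all_classical all_reals all_analysis.

Set Implicit Arguments.
Unset Strict Implicit.
Unset Printing Implicit Defensive.

Import Order.TTheory GRing.Theory Num.Theory.
Import numFieldNormedType.Exports.

Local Open Scope classical_set_scope.
Local Open Scope ring_scope.

(* Vectors of R^n are row vectors 'rV[R]_n. The library puts no sigma-algebra on
   them; as for n.-tuple R, we take the one generated by the coordinates, which
   is the Borel sigma-algebra of R^n. *)
Section measurable_rV.
Context {R : realType} (n : nat).

Definition rV_coord (i : 'I_n) (v : 'rV[R]_n) : R := v ord0 i.

Let rV_set0 : g_sigma_preimage rV_coord set0.
Proof. exact: sigma_algebra0. Qed.

Let rV_setC A : g_sigma_preimage rV_coord A -> g_sigma_preimage rV_coord (~` A).
Proof. exact: sigma_algebraC. Qed.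

Let rV_bigcup (F : (set 'rV[R]_n)^nat) :
  (forall i, g_sigma_preimage rV_coord (F i)) ->
  g_sigma_preimage rV_coord (\bigcup_i (F i)).
Proof. exact: sigma_algebra_bigcup. Qed.

HB.instance Definition _ := @isMeasurable.Build default_measure_display
  'rV[R]_n (g_sigma_preimage rV_coord) rV_set0 rV_setC rV_bigcup.

Lemma measurable_rV_coord (i : 'I_n) : measurable_fun setT (rV_coord i).
Proof.
move=> _ A mA; rewrite setTI; apply: sub_sigma_algebra.
rewrite (bigD1 i)//=; left; exists A => //; by rewrite setTI.
Qed.

Lemma measurable_rV_box (A : 'I_n -> set R) : (forall i, measurable (A i)) ->
  measurable [set v : 'rV[R]_n | forall i, A i (v ord0 i)].
Proof.
move=> mA; have -> : [set v : 'rV[R]_n | forall i, A i (v ord0 i)] =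
    \bigcap_(i in [set: 'I_n]) (rV_coord i @^-1` A i).
  by apply/seteqP; split => v /= vA i; [move=> _|]; exact: vA.
apply: fin_bigcap_measurable => // i _.
by rewrite -[X in measurable X]setTI; exact: measurable_rV_coord.
Qed.

Lemma measurable_fun_rV d (T : measurableType d) (f : T -> 'rV[R]_n) :
  (forall i, measurable_fun setT (fun x => f x ord0 i)) -> measurable_fun setT f.
Proof.
move=> mf; apply: (@measurability _ _ _ _ _ _
  (\big[setU/set0]_(i < n) preimage_set_system setT (rV_coord i) measurable)) => //.
move=> _ [A + <-]; rewrite setTI.
elim/big_ind : _ => //= [B C ihB ihC []//|i _ [B mB <-]].
by rewrite setTI -[X in measurable X]setTI; exact: mf.
Qed.

End measurable_rV.

(* Lebesgue measure on R^n, by recursion on n as the image of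
   (Lebesgue measure on R) \x (Lebesgue measure on R^n) under the map
   R * R^n -> R^(n+1) which adds a first coordinate. *)
Section lebesgue_rV.
Context {R : realType}.

Definition rV_cons n (p : R * 'rV[R]_n) : 'rV[R]_n.+1 :=
  row_mx (p.1%:M : 'rV[R]_1) p.2.

Lemma rV_cons0 n (p : R * 'rV[R]_n) : rV_cons p ord0 ord0 = p.1.
Proof.
transitivity (rV_cons p ord0 (lshift n (@ord0 0))).
  by congr (rV_cons p ord0 _); exact/val_inj.
by apply: etrans (row_mxEl _ _ _ _) _; rewrite mxE eqxx mulr1n.
Qed.

Lemma rV_consS n (p : R * 'rV[R]_n) (i : 'I_n) :
  rV_cons p ord0 (lift ord0 i) = p.2 ord0 i.
Proof.
transitivity (rV_cons p ord0 (rshift 1 i)).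
  by congr (rV_cons p ord0 _); exact/val_inj.
exact: row_mxEr.
Qed.

Lemma measurable_rV_cons n : measurable_fun setT (@rV_cons n).
Proof.
apply: measurable_fun_rV => i; have [j ->|->] := unliftP ord0 i.
- under eq_fun do rewrite rV_consS.
  exact: (measurableT_comp (measurable_rV_coord j) measurable_snd).
- under eq_fun do rewrite rV_cons0.
  exact: measurable_fst.
Qed.

Section step.
Variables (n : nat) (m : {sigma_finite_measure set 'rV[R]_n -> \bar R}).

Definition lebesgue_rV_step : set 'rV[R]_n.+1 -> \bar R :=
  pushforward ((@lebesgue_measure R) \x m)%E (@rV_cons n).

Let step0 : lebesgue_rV_step set0 = 0%E.
Proof. by rewrite /lebesgue_rV_step /pushforward preimage_set0 measure0. Qed.

Let step_ge0 A : (0 <= lebesgue_rV_step A)%E.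
Proof. by rewrite /lebesgue_rV_step /pushforward measure_ge0. Qed.

Let step_sigma_additive : semi_sigma_additive lebesgue_rV_step.
Proof.
move=> F mF tF mUF; rewrite /lebesgue_rV_step /pushforward preimage_bigcup.
apply: measure_semi_sigma_additive.
- by move=> k; rewrite -[X in measurable X]setTI; exact: measurable_rV_cons.
- apply/trivIsetP => /= i j _ _ ij; rewrite -preimage_setI.
  by move/trivIsetP : tF => /(_ _ _ _ _ ij) ->//; rewrite preimage_set0.
- rewrite -preimage_bigcup -[X in measurable X]setTI.
  exact: measurable_rV_cons.
Qed.

HB.instance Definition _ := isMeasure.Build _ _ _ lebesgue_rV_step
  step0 step_ge0 step_sigma_additive.

Let step_sigma_finite : sigma_finite setT lebesgue_rV_step.
Proof.
have /sigma_finiteP[F [FT ndF mF]] := sigma_finiteT (@lebesgue_measure R).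
have /sigma_finiteP[G [GT ndG mG]] := sigma_finiteT m.
pose dec (v : 'rV[R]_n.+1) : R * 'rV[R]_n := (v ord0 ord0, \row_i v ord0 (lift ord0 i)).
have consK : cancel (@rV_cons n) dec.
  move=> [x v]; rewrite /dec rV_cons0/=; congr pair.
  by apply/rowP => i; rewrite mxE rV_consS.
have mdec : measurable_fun setT dec.
  apply/measurable_fun_pairP; split.
    exact: (measurable_rV_coord ord0).
  apply: measurable_fun_rV => i; under eq_fun do rewrite /= mxE.
  exact: (measurable_rV_coord (lift ord0 i)).
exists (fun k => dec @^-1` (F k `*` G k)).
  rewrite -preimage_bigcup (_ : \bigcup_k _ = setT) ?preimage_setT//.
  rewrite -setXTT FT GT; apply/seteqP; split => [[x v] [k _ [/= ? ?]]|].
    by split; exists k.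
  move=> [x v] [/= [i _ Fx] [k _ Gv]]; exists (maxn i k) => //; split.
  - by move: x Fx; exact/subsetPset/ndF/leq_maxl.
  - by move: v Gv; exact/subsetPset/ndG/leq_maxr.
move=> k; have [mFk Fk] := mF k; have [mGk Gk] := mG k; split.
  by rewrite -[X in measurable X]setTI; apply: mdec => //; exact: measurableX.
rewrite /lebesgue_rV_step /pushforward -comp_preimage.
rewrite (_ : dec \o _ = id); last by rewrite funeqE => p /=; rewrite consK.
by rewrite preimage_id product_measure1E// lte_mul_pinfty// ge0_fin_numE.
Qed.

HB.instance Definition _ :=
  Measure_isSigmaFinite.Build _ _ _ lebesgue_rV_step step_sigma_finite.

End step.

Fixpoint lebesgue_rV (n : nat) : {sigma_finite_measure set 'rV[R]_n -> \bar R} :=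
  if n is n'.+1 then lebesgue_rV_step (lebesgue_rV n') else dirac (0 : 'rV[R]_0).

Lemma lebesgue_rV_box n (A : 'I_n -> set R) : (forall i, measurable (A i)) ->
  lebesgue_rV n [set v | forall i, A i (v ord0 i)] =
  (\prod_(i < n) lebesgue_measure (A i))%E.
Proof.
elim: n A => [|n IHn] A mA.
  rewrite big_ord0 /= diracE mem_set//=.
  by case.
have E : @rV_cons n @^-1` [set v | forall i, A i (v ord0 i)] =
    A ord0 `*` [set v : 'rV[R]_n | forall i : 'I_n, A (lift ord0 i) (v ord0 i)].
  apply/seteqP; split => [[x v] /= H|[x v] [/= Ax Av] i].
    split => /=; first by have := H ord0; rewrite rV_cons0.
    by move=> i; have := H (lift ord0 i); rewrite rV_consS.
  have [j ->|->] := unliftP ord0 i; first by rewrite rV_consS; exact: Av.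
  by rewrite rV_cons0.
rewrite big_ord_recl -IHn//= /lebesgue_rV_step /pushforward E.
rewrite product_measure1E//=; first exact: (mA ord0).
by apply: (@measurable_rV_box _ _ (fun i => A (lift ord0 i))) => i; exact: mA.
Qed.

End lebesgue_rV.

Section calculus.
Context {R : realType} {n : nat}.
Implicit Types (f : 'rV[R]_n -> R) (F : 'rV[R]_n -> 'rV[R]_n).

Definition partial (i : 'I_n) f : 'rV[R]_n -> R := 'D_(delta_mx ord0 i) f.

Definition grad f : 'rV[R]_n -> 'rV[R]_n := fun x => \row_i partial i f x.

(* f is of class C^k on R^n. *)
Fixpoint class_C (k : nat) f : Prop :=
  if k is k'.+1 then
    [/\ continuous f,
        forall i x, derivable f x (delta_mx ord0 i) &
        forall i, class_C k' (partial i f)]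
  else continuous f.

Definition test_function f : Prop :=
  (forall k, class_C k f) /\ compact (closure [set x | f x != 0]).

Definition dotmx (v w : 'rV[R]_n) : R := \sum_i v ord0 i * w ord0 i.

(* The pairing <div F, phi> = - \int F . grad phi; the integrand is integrable
   as soon as F is locally integrable, e.g. F = sigma grad u with sigma in
   L^infty_loc and u in C^1. *)
Definition distr_div F (phi : 'rV[R]_n -> R) : R :=
  - \int[lebesgue_rV n]_x dotmx (F x) (grad phi x).

Definition Linfty_loc f : Prop :=
  measurable_fun setT f /\
  forall K, compact K ->
    exists C : R, {ae lebesgue_rV n, forall x, K x -> `|f x| <= C}.

(* An L^infty_loc function is a class modulo null sets: a function which is
   positive almost everywhere has a representative positive everywhere. *)
Definition isotropically_realizable F : Prop :=
  exists sigma : 'rV[R]_n -> R,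
    [/\ Linfty_loc sigma, forall x, 0 < sigma x &
        forall phi, test_function phi ->
          distr_div (fun x => sigma x *: F x) phi = 0].

(* The closed parallelepiped with vertex a and edges the rows of M, which are
   linearly independent when M is invertible. *)
Definition parallelepiped (a : 'rV[R]_n) (M : 'M[R]_n) : set 'rV[R]_n :=
  [set a + t *m M | t in [set t : 'rV[R]_n | forall i, 0 <= t ord0 i <= 1]].

(* Y-periodicity for Y = parallelepiped a M. *)
Definition edge_periodic (M : 'M[R]_n) F : Prop :=
  forall x i, F (x + row i M) = F x.

Definition average (Y : set 'rV[R]_n) F : 'rV[R]_n :=
  \row_i ((fine (lebesgue_rV n Y))^-1 * \int[lebesgue_rV n]_(x in Y) F x ord0 i).

End calculus.

(* Main.v *)
From HB Require Import structures.
Require Import Defs.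
From mathcomp Require Import all_boot all_order all_algebra.
From mathcomp Require Import all_classical all_reals all_analysis.
From mathcomp Require Import measurable_realfun ring lra.

(* Let F = grad u / |grad u|^2 and g = Lap u / |grad u|^2, so that the derivative
   of u along F is 1. By periodicity F is bounded, hence its flow is global and,
   started at x, reaches {u = 0} at time - u(x). The integral w(x) of g along
   this trajectory satisfies F . grad w = - g, that is
   grad u . grad w + Lap u = 0, and sigma = exp w is a conductivity.

   No flow is constructed, and w is not shown to be differentiable. Instead, w
   is the limit of w_N, obtained by N steps of length - u(x) / N of the Euler
   scheme. Each w_N is C^1, F . grad w_N + g tends to 0 locally uniformly, and
   |w_2N - w_N| is locally O(1/N), so that w_N converges along powers of 2. The
   identity div (exp w_N grad u) = exp w_N (grad u . grad w_N + Lap u) integrated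
   against a test function gives the weak equation in the limit. *)

Set Implicit Arguments.
Unset Strict Implicit.
Unset Printing Implicit Defensive.

Import Order.TTheory GRing.Theory Num.Theory.
Import numFieldNormedType.Exports.

Local Open Scope classical_set_scope.
Local Open Scope ring_scope.

(** * Balls of R^n *)

Lemma continuous_sum {R : numFieldType} (T : topologicalType) (I : finType)
    (f : I -> T -> R) :
  (forall i, continuous (f i)) -> continuous (fun x => \sum_i f i x).
Proof. by move=> cf; apply: continuous_big => //; exact: add_continuous. Qed.

Lemma continuous_add {R : numFieldType} (T : topologicalType) (f g : T -> R) :
  continuous f -> continuous g -> continuous (fun x => f x + g x).
Proof. by move=> cf cg x; exact: (continuousD (cf x) (cg x)). Qed.

Lemma continuous_mul {R : numFieldType} (T : topologicalType) (f g : T -> R) :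
  continuous f -> continuous g -> continuous (fun x => f x * g x).
Proof. by move=> cf cg x; exact: (continuousM (cf x) (cg x)). Qed.

Section row_vectors.
Context {R : realType} {n : nat}.
Implicit Types (x v : 'rV[R]_n) (f : 'rV[R]_n -> R).

Lemma ler_rV_coord v i : `|v ord0 i| <= `|v|.
Proof.
rewrite [leRHS]/Num.norm/= mx_normrE.
exact: (le_bigmax _ (fun ij => `|v ij.1 ij.2|) (ord0, i)).
Qed.

Lemma rV_norm_le v (e : R) :
  0 <= e -> (forall i, `|v ord0 i| <= e) -> `|v| <= e.
Proof.
move=> e0 ve; rewrite [leLHS]/Num.norm/= mx_normrE bigmax_le// => -[i j] _ /=.
by rewrite ord1.
Qed.

Lemma continuous_rV_coord i : continuous (fun v : 'rV[R]_n => v ord0 i).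
Proof. by move=> v; exact: (@coord_continuous R 1 n ord0 i v). Qed.

Lemma continuous_rV (T : topologicalType) (y : T -> 'rV[R]_n) :
  (forall i, continuous (fun t => y t ord0 i)) -> continuous y.
Proof.
move=> cy t; apply/cvgrPdist_le => e e0; near=> s.
apply: rV_norm_le => [|i]; first exact: ltW.
rewrite !mxE; move: i; near: s; apply: filter_forall => i.
by have /cvgrPdist_le := cy i t; exact.
Unshelve. all: by end_near. Qed.

Lemma compact_ball0 (r : R) : compact [set x : 'rV[R]_n | `|x| <= r].
Proof.
apply: bounded_closed_compact.
  by exists r; split; [exact: num_real|move=> s rs x /= /le_trans; apply; exact: ltW].
rewrite (_ : mkset _ = Num.norm @^-1` [set y | y <= r])//.
by apply: closed_comp => [x _|]; [exact: norm_continuous|exact: closed_le].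
Qed.

(** Closed balls are compact. The bound is made strictly positive so that it can serve later as a
    divisor. *)
Lemma continuous_bounded_ball f (r : R) : continuous f ->
  exists2 C, 0 < C & forall x, `|x| <= r -> `|f x| <= C.
Proof.
move=> cf; have /compact_bounded[C [_ CP]] :
    compact (f @` [set x : 'rV[R]_n | `|x| <= r]).
  apply: continuous_compact; last exact: compact_ball0.
  exact: continuous_subspaceT.
(* Boundedness provides a bound by each real strictly above [C]; this one is also positive. *)
exists (`|C| + 1); first by rewrite ltr_wpDl.
move=> x xr; apply: (CP (`|C| + 1)); last by exists x.
by rewrite (le_lt_trans (ler_norm _))// ltrDl.
Qed.

Lemma continuous_bounded_ball_fin (I : finType) (f : I -> 'rV[R]_n -> R)
    (r : R) : (forall i, continuous (f i)) ->
  exists2 C, 0 < C & forall i x, `|x| <= r -> `|f i x| <= C.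
Proof.
move=> cf.
have /choice[C CP] : forall i, exists C,
    0 < C /\ forall x, `|x| <= r -> `|f i x| <= C.
  by move=> i; have [C C0 CP] := continuous_bounded_ball r (cf i); exists C.
(* The summand 1 keeps the constant positive when the family is empty. *)
exists (1 + \sum_i C i).
  by rewrite ltr_wpDr// sumr_ge0// => i _; exact: ltW (CP i).1.
move=> i x xr; rewrite (le_trans ((CP i).2 x xr))// (bigD1 i)//=.
rewrite addrCA lerDl addr_ge0// sumr_ge0// => j _; exact: ltW (CP j).1.
Qed.

(** Heine's theorem in a form where only [x] is confined to the ball, while [x + v] may leave it. *)
Lemma unif_continuous_ball f (r e : R) : continuous f -> 0 < e ->
  exists2 d, 0 < d &
    forall x v, `|x| <= r -> `|v| <= d -> `|f (x + v) - f x| <= e.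
Proof.
move=> cf e0.
(* Compactness as a covering principle: an estimate that holds for points near each [x] of the ball
   and for [v] near 0 holds on the whole ball for [v] near 0. *)
have cov := (near_covering_withinP _).2
  ((compact_near_coveringP _).1 (@compact_ball0 r)).
have /nbhs_ballP[d /= d0 dP] : \forall v \near (0 : 'rV[R]_n),
    [set x : 'rV[R]_n | `|x| <= r] `<=` (fun x => `|f (x + v) - f x| <= e).
  apply: (cov _ (nbhs (0 : 'rV[R]_n))
    (fun v x => `|f (x + v) - f x| <= e)) => x _.
  have /cvgrPdist_lt/(_ (e / 2)) := cf x.
  rewrite divr_gt0// => /(_ isT) fx.
  have fx2 : \forall y \near x & v \near (0 : 'rV[R]_n), `|f x - f (y + v)| < e / 2.
    have : (y.1 + y.2 : 'rV[R]_n) @[y --> (x, (0 : 'rV[R]_n))] --> x.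
      rewrite -[X in _ --> X]addr0; exact: (cvgD cvg_fst cvg_snd).
    move=> /(_ _ fx) /= [[A B]] /= [xA yB] AB.
    by exists (A, B) => //= -[a b] /= ?; apply: (AB (a, b)).
  have fx1 : \forall y \near x & v \near (0 : 'rV[R]_n), `|f x - f y| < e / 2.
    exists ([set y | `|f x - f y| < e / 2], setT) => [/=|[y v] []//].
    by split => //; exact: filterT.
  apply: filterS2 fx1 fx2 => -[y v] /= h1 h2 _.
  rewrite ltW// (splitr e) -(subrKA (f x)) (le_lt_trans (ler_normD _ _))//.
  by rewrite ltrD// distrC.
(* Halving turns the open ball of radius [d] into a non-strict bound on [v]. *)
exists (d / 2); first by rewrite divr_gt0.
move=> x v xr vd; apply: (dP v) => //=.
by rewrite -ball_normE/= sub0r normrN (le_lt_trans vd)// ltr_pdivrMr// ltr_pMr// ltr1n.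
Qed.

End row_vectors.

(** * Calculus of C^1 functions *)

(** The epsilon form of the little-o expansion; by uniqueness, the continuous linear map [df] is
    then the differential. *)
Lemma differentiable_linear_approx (R : numFieldType) (V W : normedModType R)
    (f : V -> W) (df : {linear V -> W}) x : continuous df ->
  (forall e, 0 < e -> \forall v \near 0, `|f (v + x) - f x - df v| <= e * `|v|) ->
  differentiable f x.
Proof.
move=> dfc fe; have fE : f \o shift x = cst (f x) + df +o_ 0 id.
  apply/eqaddoP => e e0; near=> v.
  rewrite [X in `|X|](_ : _ = f (v + x) - f x - df v); last first.
    by rewrite -addrA -opprD.
  by near: v; exact: fe.
by apply/diff_locallyP; rewrite (diff_unique dfc fE).
Unshelve. all: by end_near. Qed.

(** * Mean value theorem on segments and on broken lines *)

Section mean_value.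
Context {R : realType} {n : nat}.
Implicit Types (x v e : 'rV[R]_n) (f : 'rV[R]_n -> R).

Lemma is_derive_line f x e (s : R) : derivable f (x + s *: e) e ->
  is_derive s 1 (fun t => f (x + t *: e)) ('D_e f (x + s *: e)).
Proof.
have E : (fun h : R => h^-1 *: (((fun t => f (x + t *: e)) \o shift s) h%:A
      - f (x + s *: e))) =
    (fun h => h^-1 *: ((f \o shift (x + s *: e)) (h *: e) - f (x + s *: e))).
  apply/funext => h /=; congr (_ *: (f _ - _)).
  by rewrite [h%:A]mulr1 scalerDl addrCA.
by move=> fe; split; rewrite /derivable /derive E.
Qed.

(** The one-variable theorem on the segment between 0 and [t]. Since [t] may have either sign, the
    intermediate point is located by its absolute value. *)
Lemma mean_value_line f x e (t : R) : (forall y, derivable f y e) ->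
  exists2 c, `|c| <= `|t| & f (x + t *: e) - f x = t * 'D_e f (x + c *: e).
Proof.
move=> fe; have fd s := @is_derive_line f x e s (fe _).
have fc (A : set R) : {within A, continuous (fun t => f (x + t *: e))}.
  apply: continuous_subspaceT => s.
  by apply/differentiable_continuous/derivable1_diffP; have [] := fd s.
have [t0|t0] := leP 0 t.
  have [c] := MVT_segment t0 (fun s _ => fd s) (fc _).
  rewrite in_itv/= scale0r addr0 subr0 => /andP[c0 ct] ->.
  by exists c; [rewrite !ger0_norm|rewrite mulrC].
have [c] := MVT_segment (ltW t0) (fun s _ => fd s) (fc _).
rewrite in_itv/= scale0r addr0 sub0r => /andP[c0 ct] /eqP.
rewrite -eqr_opp opprB mulrN opprK => /eqP ->.
by exists c; [rewrite !ler0_norm ?lerN2// ltW|rewrite mulrC].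
Qed.

(* Joins x to x + v by segments parallel to the axes. *)
Lemma mean_value_partial f x v :
  (forall i y, derivable f y (delta_mx ord0 i)) ->
  exists2 xi : 'I_n -> 'rV[R]_n, forall i, `|xi i| <= `|v| &
    f (x + v) - f x = \sum_i v ord0 i * partial i f (x + xi i).
Proof.
move=> fd.
(* Vertices of the broken line: [p k] keeps the first [k] coordinates of [v], so it runs from 0 to
   [v] and changes one coordinate at a time. *)
pose p k : 'rV[R]_n := \row_(i < n) (if (i < k)%N then v ord0 i else 0).
have pS (k : 'I_n) : p k.+1 = p k + v ord0 k *: delta_mx ord0 k.
  apply/rowP => i; rewrite !mxE eqxx/= ltnS -(inj_eq val_inj)/=.
  by case: (ltngtP i k) => [| |/val_inj ->]; rewrite ?mulr0 ?mulr1 ?addr0 ?add0r.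
have /choice[xi xiP] : forall k : 'I_n, exists xi, `|xi| <= `|v| /\
    f (x + p k.+1) - f (x + p k) = v ord0 k * partial k f (x + xi).
  move=> k; have [c cv fE] :=
    @mean_value_line f (x + p k) (delta_mx ord0 k) (v ord0 k) (fd k).
  exists (p k + c *: delta_mx ord0 k); split.
    apply: rV_norm_le => // i; rewrite !mxE eqxx/=.
    have [->|ik] := eqVneq i k.
      by rewrite ltnn add0r mulr1 (le_trans cv)// ler_rV_coord.
    rewrite mulr0 addr0; case: ifP => _; first exact: ler_rV_coord.
    by rewrite normr0.
  by rewrite pS addrA fE addrA.
exists xi; first by move=> i; exact: (xiP i).1.
have p0 : p 0 = 0 by apply/rowP => i; rewrite !mxE.
have pn : p n = v by apply/rowP => i; rewrite !mxE ltn_ord.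
rewrite -[in LHS]pn -[X in _ - f X]addr0 -p0.
rewrite -(@telescope_sumr _ 0 n (fun k => f (x + p k)))// big_mkord.
by apply: eq_bigr => i _; exact: (xiP i).2.
Qed.

End mean_value.

(** * Taylor and Lipschitz estimates, operations on C^1 functions *)

Section C1.
Context {R : realType} {n : nat}.
Implicit Types (x v : 'rV[R]_n) (f g : 'rV[R]_n -> R).

Lemma class_CS k f : class_C k.+1 f -> class_C k f.
Proof. by elim: k f => [|k IH] f [] // fc fd fp; split => // i; exact: IH. Qed.

(** By [mean_value_partial] the remainder is a sum of terms v_i (d_i f (x + xi_i) - d_i f (x)), and
    the partial derivatives are uniformly continuous on the ball. *)
Lemma partial_taylor f (r e : R) : class_C 1 f -> 0 < e ->
  exists2 d, 0 < d & forall x v, `|x| <= r -> `|v| <= d ->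
    `|f (x + v) - f x - \sum_i v ord0 i * partial i f x| <= e * `|v|.
Proof.
move=> [_ fd fp] e0.
(* There are [n] terms to absorb; [n.+1] avoids a division by 0 in dimension 0. *)
have e0' : 0 < e / n.+1%:R by rewrite divr_gt0.
have /choice[d dP] : forall i, exists d, 0 < d /\ forall x v,
    `|x| <= r -> `|v| <= d -> `|partial i f (x + v) - partial i f x| <= e / n.+1%:R.
  by move=> i; have [d d0 dP] := unif_continuous_ball r (fp i) e0'; exists d.
exists (\big[Num.min/1]_i d i).
  by apply: lt_bigmin => [|i _]; [exact: ltr01|exact: (dP i).1].
move=> x v xr vd; have [xi xiv ->] := mean_value_partial x v fd.
rewrite -sumrB (le_trans (ler_norm_sum _ _ _))//.
apply: (@le_trans _ _ (\sum_(i < n) e / n.+1%:R * `|v|)).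
  apply: ler_sum => i _; rewrite -mulrBr normrM mulrC ler_pM//.
    apply: (dP i).2 => //; rewrite (le_trans (xiv i))// (le_trans vd)//.
    exact: bigmin_le.
  exact: ler_rV_coord.
rewrite sumr_const card_ord -[leLHS]mulr_natl mulrCA mulrA ler_wpM2r//.
by rewrite mulrAC ler_pdivrMr// ler_pM2l// ler_nat.
Qed.

Lemma lipschitz_ball f (r : R) : class_C 1 f ->
  exists2 L, 0 < L & forall x y, `|x| <= r -> `|y| <= r ->
    `|f x - f y| <= L * `|x - y|.
Proof.
(* The intermediate points are within |x - y| <= 2 r of [y], hence in the ball of radius 3 r. *)
move=> [_ fd fp]; have [C C0 CP] := continuous_bounded_ball_fin (3 * r) fp.
exists (n.+1%:R * C); first by rewrite mulr_gt0.
move=> x y xr yr; have [xi xiv] := mean_value_partial y (x - y) fd.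
rewrite [y + _]addrC subrK => ->; rewrite (le_trans (ler_norm_sum _ _ _))//.
apply: (@le_trans _ _ (\sum_(i < n) C * `|x - y|)).
  apply: ler_sum => i _; rewrite normrM mulrC ler_pM//; last exact: ler_rV_coord.
  apply: CP; rewrite (le_trans (ler_normD _ _))//.
  have := xiv i; have := ler_normB x y; lra.
rewrite sumr_const card_ord -[leLHS]mulr_natl mulrA ler_wpM2r// ler_wpM2r ?ler_nat//.
exact: ltW.
Qed.

(** The candidate differential is the linear form given by the partial derivatives at [x];
    [partial_taylor] on the ball of radius |x| gives the required expansion. *)
Lemma class_C1_differentiable f x : class_C 1 f -> differentiable f x.
Proof.
move=> f1.
have lin : linear (fun v : 'rV[R]_n => \sum_i v ord0 i * partial i f x).
  move=> a u v; rewrite scaler_sumr -big_split/=; apply: eq_bigr => i _.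
  by rewrite !mxE mulrDl -mulrA.
pose dlin := GRing.isLinear.Build _ _ _ _ _ lin.
pose df : {linear 'rV[R]_n -> R} :=
  HB.pack (fun v : 'rV[R]_n => \sum_i v ord0 i * partial i f x) dlin.
have dfc : continuous df.
  rewrite /df/=; apply: continuous_sum => i; apply: continuous_mul.
    exact: continuous_rV_coord.
  by move=> v; exact: cst_continuous.
apply: (differentiable_linear_approx dfc) => e e0.
have [d d0 dP] := partial_taylor `|x| f1 e0.
near=> v; rewrite (addrC v); apply: dP => //.
Unshelve. all: by end_near. Qed.

Lemma derive_partial f x v : class_C 1 f ->
  'D_v f x = \sum_i v ord0 i * partial i f x.
Proof.
move=> f1; have fdiff := class_C1_differentiable x f1.
rewrite deriveE// [in LHS](row_sum_delta v) linear_sum; apply: eq_bigr => i _.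
by rewrite linearZ /partial deriveE.
Qed.

Lemma class_C1_is_derive f (df : 'I_n -> 'rV[R]_n -> R) : continuous f ->
  (forall i x, is_derive x (delta_mx ord0 i) f (df i x)) ->
  (forall i, continuous (df i)) -> class_C 1 f.
Proof.
move=> fc fd dfc; split => // i.
rewrite (_ : partial i f = df i)//.
by apply/funext => x; rewrite /partial derive_val.
Qed.

Lemma class_C1_cst (c : R) : class_C 1 (fun _ : 'rV[R]_n => c).
Proof.
by apply: (@class_C1_is_derive _ (fun _ _ => 0)) => *; exact: cst_continuous.
Qed.

Lemma class_C1_coord (j : 'I_n) : class_C 1 (fun x : 'rV[R]_n => x ord0 j).
Proof.
have dj i (x : 'rV[R]_n) : is_derive x (delta_mx ord0 i) (fun x : 'rV[R]_n => x ord0 j)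
    ((delta_mx ord0 i : 'rV[R]_n) ord0 j).
  have := is_derive_id x (delta_mx ord0 i : 'rV[R]_n) => -[dx xE].
  split; first by move/derivable_mxP : dx; exact.
  have := congr1 (fun M : 'rV[R]_n => M ord0 j) (derive_mx dx).
  by rewrite xE [in RHS]mxE => ->.
apply: (class_C1_is_derive _ dj) => [|i]; first exact: continuous_rV_coord.
exact: cst_continuous.
Qed.

Lemma class_C1D f g : class_C 1 f -> class_C 1 g -> class_C 1 (fun x => f x + g x).
Proof.
move=> [fc fd fp] [gc gd gp].
apply: (@class_C1_is_derive _ (fun i x => partial i f x + partial i g x)).
- exact: continuous_add.
- by move=> i x; apply: is_deriveD; exact: derivableP.
- by move=> i; exact: continuous_add.
Qed.

Lemma class_C1M f g : class_C 1 f -> class_C 1 g -> class_C 1 (fun x => f x * g x).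
Proof.
move=> [fc fd fp] [gc gd gp].
apply: (@class_C1_is_derive _ (fun i x => f x *: partial i g x + g x *: partial i f x)).
- exact: continuous_mul.
- by move=> i x; apply: is_deriveM; exact: derivableP.
- by move=> i; apply: continuous_add; exact: continuous_mul.
Qed.

Lemma class_C1V f : (forall x, f x != 0) -> class_C 1 f ->
  class_C 1 (fun x => (f x)^-1).
Proof.
move=> f0 [fc fd fp].
have fVc : continuous (fun x => (f x)^-1).
  by move=> x; apply: continuousV => //; exact: fc.
apply: (@class_C1_is_derive _
  (fun i x => -1 * ((f x)^-1 * (f x)^-1) * partial i f x)) => // [i x|i].
  split; first exact: derivableV.
  by rewrite (deriveV (f0 x) (fd i x)) mulN1r -expr2 exprVn.
apply: continuous_mul => //; apply: continuous_mul; last exact: continuous_mul.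
by move=> x; exact: cst_continuous.
Qed.

Lemma class_C1_sum (I : finType) (f : I -> 'rV[R]_n -> R) :
  (forall i, class_C 1 (f i)) -> class_C 1 (fun x => \sum_i f i x).
Proof.
move=> f1; elim: (index_enum I) => [|i r IH].
  by under eq_fun do rewrite big_nil; exact: class_C1_cst.
by under eq_fun do rewrite big_cons; exact: class_C1D.
Qed.

End C1.

Section chain_rule.
Context {R : realType} {n m : nat}.
Implicit Types (f : 'rV[R]_m -> R) (y : 'rV[R]_n -> 'rV[R]_m).

(** Restriction to the line through [x] directed by [v]; this reduces the chain rules below to
    functions of one real variable. *)
Lemma derive_along (W : normedModType R) (g : 'rV[R]_n -> W) x v :
  'D_v g x = 'D_1 (fun h : R => g (h *: v + x)) 0.
Proof.
rewrite /derive; set g1 := fun h => h^-1 *: _; set g2 := fun h => h^-1 *: _.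
suff -> : g1 = g2 by [].
by apply/funext => h; rewrite /g1 /g2/= scale0r add0r addr0 [h%:A]mulr1.
Qed.

(** Only the derivative of [y] along [v] is given. The restriction [p] of [y] to the line is
    differentiable at 0, and so is [f], so that differentials can be composed there. *)
Lemma is_derive_comp_C1 f y x v (dy : 'rV[R]_m) : class_C 1 f ->
  is_derive x v y dy ->
  is_derive x v (fun z => f (y z)) (\sum_j dy ord0 j * partial j f (y x)).
Proof.
move=> f1 [dyx dyE].
pose p (h : R) := y (h *: v + x).
have p0 : p 0 = y x by rewrite /p scale0r add0r.
have dp : differentiable p 0.
  by apply/derivable1_diffP; exact: (derivable1P y x v).1 dyx.
have df : differentiable f (p 0) by exact: class_C1_differentiable.
have dfp : differentiable (f \o p) 0 by exact: differentiable_comp.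
split; first by apply/(derivable1P (fun z => f (y z)))/derivable1_diffP.
have dpE : 'd p 0 1 = dy by rewrite -deriveE// -dyE (derive_along y).
transitivity ('D_1 (f \o p) 0); first exact: (derive_along (fun z => f (y z))).
rewrite deriveE// (diff_comp dp df)/= dpE p0 -deriveE -?p0//.
by rewrite derive_partial.
Qed.

Lemma is_derive_rV y x v (dy : 'rV[R]_m) :
  (forall j, is_derive x v (fun z => y z ord0 j) (dy ord0 j)) ->
  is_derive x v y dy.
Proof.
move=> dyj; have dyx : derivable y x v.
  by apply/derivable_mxP => i j; rewrite ord1; have [] := dyj j.
split => //; rewrite derive_mx//; apply/rowP => j; rewrite mxE.
by have [] := dyj j.
Qed.

Lemma class_C1_comp f y : class_C 1 f ->
  (forall j, class_C 1 (fun x => y x ord0 j)) -> class_C 1 (fun x => f (y x)).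
Proof.
move=> f1 y1.
have yc : continuous y.
  by apply: continuous_rV => j; have [] := y1 j.
have [fc _ fp] := f1.
apply: (@class_C1_is_derive _ _ _
  (fun i x => \sum_j partial i (fun z => y z ord0 j) x * partial j f (y x))).
- by move=> x; apply: (@continuous_comp _ _ _ y f); [exact: yc|exact: fc].
- move=> i x.
  have := @is_derive_comp_C1 f y x (delta_mx ord0 i)
    (\row_j partial i (fun z => y z ord0 j) x) f1.
  under eq_bigr do rewrite mxE; apply; apply: is_derive_rV => j; rewrite mxE.
  by apply: derivableP; have [_ + _] := y1 j; exact.
- move=> i; apply: continuous_sum => j; apply: continuous_mul.
    by have [_ _ +] := y1 j; exact.
  by move=> x; apply: (@continuous_comp _ _ _ y (partial j f)); [exact: yc|exact: fp].
Qed.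

End chain_rule.

Section exponential.
Context {R : realType} {n : nat}.
Implicit Types f : 'rV[R]_n -> R.

Lemma is_derive_comp_expR f x v : derivable f x v ->
  is_derive x v (fun z => expR (f z)) (expR (f x) * 'D_v f x).
Proof.
move=> fx; pose p (h : R) := f (h *: v + x).
have p0 : p 0 = f x by rewrite /p scale0r add0r.
have dp : derivable p 0 1 by exact: (derivable1P f x v).1 fx.
have [de expE] := is_derive_expR (p 0).
have dep : derivable (expR \o p) 0 1.
  by apply/derivable1_diffP/differentiable_comp; exact/derivable1_diffP.
split; first exact: (derivable1P (fun z => expR (f z)) x v).2 dep.
transitivity ('D_1 (expR \o p) 0); first exact: (derive_along (fun z => expR (f z))).
by rewrite -derive1E (derive1_comp dp de) !derive1E expE p0 -(derive_along f).
Qed.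

Lemma class_C1_expR f : class_C 1 f -> class_C 1 (fun x => expR (f x)).
Proof.
move=> [fc fd fp]; have fec : continuous (fun x => expR (f x)).
  by move=> x; apply: continuous_comp; [exact: fc|exact: continuous_expR].
apply: (@class_C1_is_derive _ _ _ (fun i x => expR (f x) * partial i f x)) => //.
  by move=> i x; exact: is_derive_comp_expR.
by move=> i; exact: continuous_mul.
Qed.

End exponential.

(** * Lebesgue measure on R^n *)

Lemma integrable_bounded_support d (T : measurableType d) (R : realType)
    (mu : {measure set T -> \bar R}) (B : set T) (f : T -> R) (C : R) :
  measurable B -> (mu B < +oo)%E -> measurable_fun setT f ->
  (forall x, B x -> `|f x| <= C) -> (forall x, ~ B x -> f x = 0) ->
  mu.-integrable setT (EFin \o f).
Proof.
move=> mB muB mf fC f0.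
have : mu.-integrable B (EFin \o f).
  apply: measurable_bounded_integrable => //; first exact: measurable_funTS.
  exists C; split; first exact: num_real.
  by move=> D CD x Bx; exact: le_trans (fC _ Bx) (ltW CD).
rewrite (integrable_mkcond _ mB); congr (_.-integrable _ _).
apply/funext => x; rewrite patchE; case: ifPn => // /negP; rewrite inE => Bx.
by rewrite /= f0.
Qed.

Section rV_measure.
Context {R : realType} {n : nat}.
Implicit Types (f : 'rV[R]_n -> R).

(** The sigma-algebra is generated by the coordinates, so boxes are measurable; an open set is the
    countable union of the boxes with rational centre and radius 1 / (k + 1) that it contains. *)
Lemma open_measurable_rV (U : set 'rV[R]_n) : open U -> measurable U.
Proof.
move=> oU.
pose box (p : 'rV[rat]_n * nat) : set 'rV[R]_n :=
  [set v | forall i, [set y | `|y - ratr (p.1 ord0 i)| < p.2.+1%:R^-1] (v ord0 i)].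
rewrite (_ : U = \bigcup_p (if `[< box p `<=` U >] then box p else set0)).
  apply: countable_bigcupT_measurable => [|p]; first exact: countableP.
  case: ifP => // _.
  apply: (@measurable_rV_box _ _
    (fun i => [set y | `|y - ratr (p.1 ord0 i)| < p.2.+1%:R^-1])) => i.
  apply: open_measurable.
  rewrite (_ : mkset _ = ball (ratr (p.1 ord0 i) : R) p.2.+1%:R^-1).
    exact: ball_open.
  by apply/seteqP; split => y; rewrite -ball_normE/= distrC.
apply/seteqP; split => [x Ux|x [p _]]; last by case: ifP => // /asboolP; exact.
have /nbhs_ballP[e /= e0 eU] := open_nbhs_nbhs (conj oU Ux).
have e2 : 0 < e / 2 by rewrite divr_gt0.
have [k ke] : exists k, k.+1%:R^-1 < e / 2.
  have /= := near_infty_natSinv_lt (PosNum e2) => -[k _ kP].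
  by exists k; apply: (kP k) => /=.
have /choice[q qP] : forall i, exists q : rat, `|x ord0 i - ratr q| < k.+1%:R^-1.
  move=> i; have [|q] :=
    @rat_in_itvoo R (x ord0 i - k.+1%:R^-1) (x ord0 i + k.+1%:R^-1).
    by rewrite ltrD2l gtrN.
  by rewrite in_itv/= => qx; exists q; rewrite distrC ltr_distl.
exists (\row_i q i, k) => //.
rewrite ifT; first by move=> i /=; rewrite mxE.
(* Both [v] and [x] are within 1 / (k + 1) < e / 2 of the centre in each coordinate. *)
apply/asboolP => v /= vP; apply: eU; rewrite -ball_normE/=.
apply: (@le_lt_trans _ _ (k.+1%:R^-1 + k.+1%:R^-1)).
  apply: rV_norm_le => // i; rewrite !mxE.
  rewrite -(subrKA (ratr (q i))) (le_trans (ler_normD _ _))// lerD ?ltW//.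
  by have := vP i; rewrite mxE distrC.
by rewrite (splitr e) ltrD.
Qed.

Lemma continuous_measurable_fun_rV f : continuous f -> measurable_fun setT f.
Proof.
move=> /continuousP cf; apply: (measurability _ (RGenOpens.measurableE R)).
move=> _ [_ [a [b ->] <-]]; rewrite setTI; apply: open_measurable_rV.
exact/cf/itv_open.
Qed.

(** For the sup norm this is a ball, written as a box so that [lebesgue_rV_box] gives its
    measure. *)
Definition rV_cube (r : R) : set 'rV[R]_n :=
  [set v | forall i, (`[- r, r]%classic : set R) (v ord0 i)].

Lemma measurable_rV_cube r : measurable (rV_cube r).
Proof. by apply: (@measurable_rV_box _ _ (fun=> `[- r, r]%classic)). Qed.

Lemma lebesgue_rV_cube_fin r : (lebesgue_rV n (rV_cube r) < +oo)%E.
Proof.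
rewrite (lebesgue_rV_box (fun=> measurable_itv `[- r, r])).
suff /andP[] : (0 <= \prod_(i < n)
  lebesgue_measure (`[(- r)%R, r]%classic : set R) < +oo)%E by [].
elim/big_ind : _ => [|x y /andP[x0 xy] /andP[y0 yy]|i _].
- by rewrite ltry lee01.
- by rewrite mule_ge0// lte_mul_pinfty// ge0_fin_numE.
- by rewrite measure_ge0 lebesgue_measure_itv/=; case: ifP => // _; exact: ltry.
Qed.

Lemma rV_cubePn r x : ~ rV_cube r x -> r < `|x|.
Proof.
move=> xr; rewrite ltNge; apply/negP => {}xr'; apply: xr => i /=.
by rewrite in_itv/= -ler_norml (le_trans (ler_rV_coord _ _)).
Qed.

Lemma integrable_rV f (r C : R) : measurable_fun setT f ->
  (forall x, `|f x| <= C) -> (forall x, r < `|x| -> f x = 0) ->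
  (lebesgue_rV n).-integrable setT (EFin \o f).
Proof.
move=> mf fC f0; apply: (@integrable_bounded_support _ _ _ _ (rV_cube r) _ C) => //.
  exact: measurable_rV_cube.
  exact: lebesgue_rV_cube_fin.
by move=> x /rV_cubePn; exact: f0.
Qed.

(** Dominated convergence, with [C] times the indicator of a cube as dominating function. *)
Lemma cvg_Rintegral_rV (f_ : nat -> 'rV[R]_n -> R) f (r C : R) :
  (forall k, measurable_fun setT (f_ k)) ->
  (forall k x, `|f_ k x| <= C) -> (forall k x, r < `|x| -> f_ k x = 0) ->
  (forall x, f_ k x @[k --> \oo] --> f x) ->
  \int[lebesgue_rV n]_x f_ k x @[k --> \oo] --> \int[lebesgue_rV n]_x f x.
Proof.
move=> mf fC f0 ff.
have mf' : measurable_fun setT f.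
  by apply: (measurable_fun_cvg mf) => x _; exact: ff.
have ig : (lebesgue_rV n).-integrable setT (EFin \o (fun x => C * \1_(rV_cube r) x)).
  apply: (@integrable_bounded_support _ _ _ _ (rV_cube r) _ `|C|) => //.
  - exact: measurable_rV_cube.
  - exact: lebesgue_rV_cube_fin.
  - by apply: measurable_funM => //; apply: measurable_indic; exact: measurable_rV_cube.
  - by move=> x xr; rewrite indicE mem_set// mulr1.
  - by move=> x xr; rewrite indicE memNset// mulr0.
have ff' : {ae lebesgue_rV n, forall x, setT x ->
    (EFin \o f_ k) x @[k --> \oo] --> (EFin \o f) x}.
  by apply: aeW => x _; apply: cvg_EFin; [exact: nearW|exact: ff].
have fg : {ae lebesgue_rV n, forall x k, setT x ->
    (`|(EFin \o f_ k) x| <= (EFin \o (fun x => (C * \1_(rV_cube r) x)%R)) x)%E}.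
  apply: aeW => x k _ /=; rewrite lee_fin indicE.
  have [xr|/negP] := boolP (x \in rV_cube r); first by rewrite mulr1.
  by rewrite inE => /rV_cubePn /f0 ->; rewrite normr0 mulr0.
have [fint _ cvg_int] := dominated_convergence measurableT
  (fun k => (measurable_EFinP _ _).2 (mf k)) ((measurable_EFinP _ _).2 mf') ff' ig fg.
apply: fine_cvg; rewrite /Rintegral fineK//.
exact: integrable_fin_num.
Qed.

End rV_measure.

(** * Integrals of derivatives of functions with bounded support *)

Lemma integral_derive_bounded_support (R : realType) (g dg : R -> R) (r : R) :
  (forall x : R, is_derive x 1 g (dg x)) -> continuous dg ->
  (forall x, r < `|x| -> g x = 0) -> (forall x, r < `|x| -> dg x = 0) ->
  (\int[@lebesgue_measure R]_x (dg x)%:E = 0)%E.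
Proof.
(* Since s > r, [g] vanishes at both ends of [-s, s] and [dg] vanishes outside it. *)
move=> gd dgc g0 dg0; pose s := `|r| + 1.
have s0 : 0 < s by rewrite /s ltr_wpDl.
have rs : r < s by rewrite /s (le_lt_trans (ler_norm _))// ltrDl.
have gc x : {for x, continuous g}.
  by apply/differentiable_continuous/derivable1_diffP; have [] := gd x.
transitivity (\int[@lebesgue_measure R]_(x in `[(- s)%R, s]) (dg x)%:E)%E.
  rewrite [RHS]integral_mkcond; apply: eq_integral => x _.
  rewrite patchE; case: ifPn => // /negP; rewrite inE/= in_itv/= -ler_norml => /negP.
  by rewrite -ltNge => xs; rewrite dg0// (lt_trans rs).
rewrite (@continuous_FTC2 R dg g).
- by rewrite !g0 ?normrN ?gtr0_norm// subee.
- by rewrite gtrN.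
- exact: continuous_subspaceT.
- split; first by move=> x _; have [] := gd x.
  + by apply: cvg_at_right_filter; exact: gc.
  + by apply: cvg_at_left_filter; exact: gc.
- by move=> x _; rewrite derive1E; have [] := gd x.
Qed.

Section integral_partial.
Context {R : realType}.

(** The set r < |y| is open, so near [x] the function coincides with the constant 0. *)
Lemma partial_bounded_support n (f : 'rV[R]_n -> R) (r : R) i x :
  (forall y, r < `|y| -> f y = 0) -> r < `|x| -> partial i f x = 0.
Proof.
move=> f0 xr.
rewrite /partial -(derive_cst (V := 'rV[R]_n) (0 : R) x (delta_mx ord0 i)).
apply: near_eq_derive.
have oU : open [set y : 'rV[R]_n | r < `|y|].
  rewrite (_ : mkset _ = Num.norm @^-1` [set y | r < y])//.
  apply: open_comp => [y _|]; [exact: norm_continuous|exact: open_gt].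
have := open_nbhs_nbhs (conj oU xr).
by apply: filterS => y /f0.
Qed.

Lemma rV_cons_line n (x h : R) (v : 'rV[R]_n) :
  h *: delta_mx ord0 ord0 + rV_cons (x, v) = rV_cons (h + x, v).
Proof.
apply/rowP => i; rewrite mxE.
have [j ->|->] := unliftP ord0 i; first by rewrite !rV_consS !mxE/= mulr0 add0r.
by rewrite !rV_cons0 !mxE/= mulr1.
Qed.

Lemma rV_cons_lineS n (x h : R) (v : 'rV[R]_n) j :
  h *: delta_mx ord0 (lift ord0 j) + rV_cons (x, v) =
  rV_cons (x, h *: delta_mx ord0 j + v).
Proof.
apply/rowP => i; rewrite mxE.
have [k ->|->] := unliftP ord0 i.
  by rewrite !rV_consS/= !mxE (inj_eq lift_inj).
by rewrite !rV_cons0 !mxE/= mulr0 add0r.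
Qed.

Lemma is_derive_rV_cons1 n (f : 'rV[R]_n.+1 -> R) x (v : 'rV[R]_n) :
  derivable f (rV_cons (x, v)) (delta_mx ord0 ord0) ->
  is_derive x 1 (fun y => f (rV_cons (y, v))) (partial ord0 f (rV_cons (x, v))).
Proof.
have E : (fun h : R => h^-1 *: (((fun y => f (rV_cons (y, v))) \o shift x) h%:A
      - f (rV_cons (x, v)))) =
    (fun h => h^-1 *: ((f \o shift (rV_cons (x, v))) (h *: delta_mx ord0 ord0)
      - f (rV_cons (x, v)))).
  by apply/funext => h /=; rewrite rV_cons_line [h%:A]mulr1.
by move=> fx; split; rewrite /partial /derivable /derive E.
Qed.

Lemma is_derive_rV_consS n (f : 'rV[R]_n.+1 -> R) x (v : 'rV[R]_n) j :
  derivable f (rV_cons (x, v)) (delta_mx ord0 (lift ord0 j)) ->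
  is_derive v (delta_mx ord0 j) (fun w => f (rV_cons (x, w)))
    (partial (lift ord0 j) f (rV_cons (x, v))).
Proof.
have E : (fun h : R => h^-1 *: (((fun w => f (rV_cons (x, w))) \o shift v)
      (h *: delta_mx ord0 j) - f (rV_cons (x, v)))) =
    (fun h => h^-1 *: ((f \o shift (rV_cons (x, v)))
      (h *: delta_mx ord0 (lift ord0 j)) - f (rV_cons (x, v)))).
  by apply/funext => h /=; rewrite rV_cons_lineS.
by move=> fx; split; rewrite /partial /derivable /derive E.
Qed.

Lemma rV_cons_continuous2 n x : continuous (fun v : 'rV[R]_n => rV_cons (x, v)).
Proof.
apply: continuous_rV => i; have [j ->|->] := unliftP ord0 i.
  by under eq_fun do rewrite rV_consS; exact: continuous_rV_coord.
by under eq_fun do rewrite rV_cons0; move=> v; exact: cst_continuous.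
Qed.

Lemma rV_cons_continuous1 n (v : 'rV[R]_n) : continuous (fun x : R => rV_cons (x, v)).
Proof.
apply: continuous_rV => i; have [j ->|->] := unliftP ord0 i.
  by under eq_fun do rewrite rV_consS; move=> x; exact: cst_continuous.
by under eq_fun do rewrite rV_cons0; move=> x; exact: cvg_id.
Qed.

Lemma ler_norm_rV_cons1 n (x : R) (v : 'rV[R]_n) : `|x| <= `|rV_cons (x, v)|.
Proof. by have := ler_rV_coord (rV_cons (x, v)) ord0; rewrite rV_cons0. Qed.

Lemma ler_norm_rV_cons2 n (x : R) (v : 'rV[R]_n) : `|v| <= `|rV_cons (x, v)|.
Proof.
apply: rV_norm_le => // i.
by have := ler_rV_coord (rV_cons (x, v)) (lift ord0 i); rewrite rV_consS.
Qed.

(** Fubini along the recursive definition of the measure, with the order of integration chosen so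
    that the inner integral is the one containing the variable of differentiation. *)
Lemma integral_partial n (f : 'rV[R]_n -> R) (r : R) i : continuous f ->
  (forall x, derivable f x (delta_mx ord0 i)) -> continuous (partial i f) ->
  (forall x, r < `|x| -> f x = 0) ->
  (\int[lebesgue_rV n]_x (partial i f x)%:E = 0)%E.
Proof.
elim: n f i => [f []//|n IHn] f i fc fd fp f0.
have p0 x : r < `|x| -> partial i f x = 0 by exact: partial_bounded_support.
have [C C0 fC] := continuous_bounded_ball r fp.
have mp : measurable_fun setT (partial i f) by exact: continuous_measurable_fun_rV.
have pC x : `|partial i f x| <= C.
  have [|/p0 ->] := leP `|x| r; first exact: fC.
  by rewrite normr0 ltW.
have ip := integrable_rV mp pC p0.
have mpE : measurable_fun setT (EFin \o partial i f) by exact/measurable_EFinP.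
have ipc : ((@lebesgue_measure R) \x lebesgue_rV n)%E.-integrable setT
    ((EFin \o partial i f) \o @rV_cons R n).
  have mcons A : measurable A -> measurable (@rV_cons R n @^-1` A).
    by move=> mA; rewrite -[X in measurable X]setTI; exact: measurable_rV_cons.
  have bs := @integrable_bounded_support _ _ R
    ((@lebesgue_measure R) \x lebesgue_rV n)%E (@rV_cons R n @^-1` rV_cube r)
    (partial i f \o @rV_cons R n) C.
  apply: bs.
  - by apply: mcons; exact: measurable_rV_cube.
  - exact: (@lebesgue_rV_cube_fin R n.+1 r).
  - by apply: (measurableT_comp mp); exact: measurable_rV_cons.
  - by move=> p _; exact: pC.
  - by move=> p pr; apply: p0; exact: rV_cubePn pr.
transitivity (\int[(@lebesgue_measure R) \x lebesgue_rV n]_p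
    ((EFin \o partial i f) \o @rV_cons R n) p)%E.
  refine (integral_pushforward _ mpE ipc measurableT).
  by move=> _ A mA; exact: (@measurable_rV_cons R n).
(* If the coordinate [i] is not the first, the inner integral is over R^n and vanishes by
   induction. *)
have [j ij|i0] := unliftP ord0 i.
  rewrite {i}ij in fd fp {p0 fC mp pC ip mpE} ipc *.
  rewrite -(integral12_prod_meas1 ipc) /fubini_F.
  under eq_integral => x _.
    rewrite (_ : integral _ _ _ = 0%E); first over.
    have fxd v := is_derive_rV_consS (fd (rV_cons (x, v))).
    have pE v : partial (lift ord0 j) f (rV_cons (x, v)) =
        partial j (fun w => f (rV_cons (x, w))) v.
      by have [_ <-] := fxd v.
    rewrite /=; under eq_integral do rewrite pE.
    apply: IHn.
    - by move=> v; apply: continuous_comp; [exact: rV_cons_continuous2|exact: fc].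
    - by move=> v; have [] := fxd v.
    - rewrite (_ : partial j _ = fun v => partial (lift ord0 j) f (rV_cons (x, v))).
        by move=> v; apply: continuous_comp; [exact: rV_cons_continuous2|exact: fp].
      by apply/funext => v.
    - by move=> v rv; apply: f0; exact: lt_le_trans rv (ler_norm_rV_cons2 _ _).
  by rewrite integral0.
(* For the first coordinate, the inner integral is over R and vanishes by the fundamental theorem of
   calculus. *)
rewrite {i}i0 in fd fp p0 {fC mp pC ip mpE} ipc *.
rewrite -(integral21_prod_meas1 ipc) /fubini_G.
under eq_integral => v _.
  rewrite (_ : integral _ _ _ = 0%E); first over.
  apply: (@integral_derive_bounded_support R (fun x => f (rV_cons (x, v))) _ r).
  - by move=> x; exact: is_derive_rV_cons1.
  - by move=> x; apply: continuous_comp; [exact: rV_cons_continuous1|exact: fp].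
  - by move=> x rx; apply: f0; exact: lt_le_trans rx (ler_norm_rV_cons1 _ _).
  - by move=> x rx; apply: p0; exact: lt_le_trans rx (ler_norm_rV_cons1 _ _).
by rewrite integral0.
Qed.

End integral_partial.

(** * Euler scheme *)

Section gronwall.
Context {R : realType}.

(** An explicit supersolution of the recursion E_(k+1) = E_k + (a / N) E_k + b / N with E_0 = 0. It
    bounds the errors accumulated over [k] steps out of [N]. *)
Definition gronwall (a b : R) (N k : nat) : R :=
  b * (k%:R / N%:R) * (1 + a / N%:R) ^+ k.

Lemma gronwall0 a b N : gronwall a b N 0 = 0.
Proof. by rewrite /gronwall mul0r mulr0 mul0r. Qed.

Lemma gronwall_ge0 a b N k : 0 <= a -> 0 <= b -> 0 <= gronwall a b N k.
Proof.
by move=> a0 b0; rewrite mulr_ge0 ?exprn_ge0 ?addr_ge0 ?mulr_ge0 ?divr_ge0.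
Qed.

Lemma gronwallS a b N k : 0 <= a -> 0 <= b ->
  gronwall a b N k + a / N%:R * gronwall a b N k + b / N%:R <= gronwall a b N k.+1.
Proof.
move=> a0 b0; rewrite -{1}(mul1r (gronwall _ _ _ _)) -mulrDl /gronwall mulrCA -exprS.
rewrite -natr1 mulrDl mulrDr mulrDl lerD2l mul1r ler_peMr ?divr_ge0//.
by rewrite exprn_ege1// lerDl divr_ge0.
Qed.

(** From (1 + a / N)^N <= exp a; the bound does not depend on [N]. *)
Lemma gronwall_le a b N : 0 <= a -> 0 <= b -> (0 < N)%N ->
  gronwall a b N N <= b * expR a.
Proof.
move=> a0 b0 N0; rewrite /gronwall divff ?pnatr_eq0 -?lt0n// mulr1.
rewrite ler_wpM2l// (@le_trans _ _ (expR (a / N%:R) ^+ N))//.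
  by rewrite lerXn2r ?nnegrE ?expR_ge0 ?addr_ge0 ?divr_ge0 ?expR_ge1Dx.
by rewrite -expRM_natl mulrC divfK// pnatr_eq0 -lt0n.
Qed.

End gronwall.

(** * Euler iterates and halving of the step *)

Section euler.
Context {R : realType} {n : nat}.
Variables (F : 'rV[R]_n -> 'rV[R]_n) (g : 'rV[R]_n -> R).

(** [euler_pos] is the Euler scheme for y' = F y from [x], with a step [h] of any sign; [euler_int]
    is the left Riemann sum of [g] along it. *)
Fixpoint euler_pos (h : R) (k : nat) (x : 'rV[R]_n) : 'rV[R]_n :=
  if k is k'.+1 then euler_pos h k' x + h *: F (euler_pos h k' x) else x.

Fixpoint euler_int (h : R) (k : nat) (x : 'rV[R]_n) : R :=
  if k is k'.+1 then euler_int h k' x + h * g (euler_pos h k' x) else 0.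

Hypothesis F1 : forall i, class_C 1 (fun x => F x ord0 i).
Hypothesis g1 : class_C 1 g.

Lemma euler_pos_class_C1 (h : 'rV[R]_n -> R) k i : class_C 1 h ->
  class_C 1 (fun x => euler_pos (h x) k x ord0 i).
Proof.
move=> h1; elim: k i => [|k IH] i /=; first exact: class_C1_coord.
under eq_fun do rewrite !mxE.
apply: class_C1D => //; apply: class_C1M => //.
exact: (class_C1_comp (F1 i)).
Qed.

Lemma euler_int_class_C1 (h : 'rV[R]_n -> R) k : class_C 1 h ->
  class_C 1 (fun x => euler_int (h x) k x).
Proof.
move=> h1; elim: k => [|k IH] /=; first exact: class_C1_cst.
apply: class_C1D => //; apply: class_C1M => //.
by apply: (class_C1_comp g1) => i; exact: euler_pos_class_C1.
Qed.

Variable B : R.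
Hypothesis FB : forall x, `|F x| <= B.

Let B0 : 0 <= B. Proof. exact: le_trans (FB 0). Qed.

Lemma euler_pos_dist h k x : `|euler_pos h k x - x| <= k%:R * `|h| * B.
Proof.
elim: k => [|k IH] /=; first by rewrite subrr normr0 !mul0r.
rewrite addrAC (le_trans (ler_normD _ _))// -natr1 !mulrDl mul1r lerD//.
by rewrite normrZ ler_wpM2l.
Qed.

(** [U] bounds the total time. All iterates stay in one ball independent of the number of steps, on
    which constants for [F] and [g] can be fixed. *)
Lemma euler_pos_ball h k x (r U : R) : k%:R * `|h| <= U -> `|x| <= r ->
  `|euler_pos h k x| <= r + U * B.
Proof.
move=> kU xr; rewrite -(subrK x (euler_pos _ _ _)) addrC (le_trans (ler_normD _ _))//.
by rewrite lerD// (le_trans (euler_pos_dist _ _ _))// ler_wpM2r.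
Qed.

Lemma euler_int_bound h k x (r U G : R) : k%:R * `|h| <= U -> `|x| <= r ->
  (forall y, `|y| <= r + U * B -> `|g y| <= G) ->
  `|euler_int h k x| <= k%:R * `|h| * G.
Proof.
move=> kU xr gG; elim: k kU => [|k IH] kU /=; first by rewrite normr0 !mul0r.
have kU' : k%:R * `|h| <= U by rewrite (le_trans _ kU)// ler_wpM2r// ler_nat.
rewrite (le_trans (ler_normD _ _))// -natr1 !mulrDl mul1r lerD ?IH//.
by rewrite normrM ler_wpM2l// gG// (euler_pos_ball (k := k)).
Qed.

(** Two half steps from [z], passing through [w], against one full step from [y]. The values [p] and
    [q] being updated are the positions when [f] is [F], the Riemann sums when [f] is [g]. The last
    term of the bound is the local error, due to |w - z| <= t B. *)
Lemma half_step_le (V : normedModType R) (f : 'rV[R]_n -> V) (h t L E : R)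
    (p q : V) y z w :
  `|h| <= t -> 0 <= L -> 0 <= E -> `|p - q| <= E -> `|z - y| <= E ->
  `|f z - f y| <= L * `|z - y| -> `|f w - f y| <= L * `|w - y| ->
  w = z + (h / 2) *: F z ->
  `|p + (h / 2) *: f z + (h / 2) *: f w - (q + h *: f y)| <=
  E + t * L * E + t * L * (t * B).
Proof.
move=> ht L0 E0 pq zy fz fw wE; have t0 : 0 <= t := le_trans (normr_ge0 _) ht.
have -> : p + (h / 2) *: f z + (h / 2) *: f w - (q + h *: f y) =
    p - q + (h / 2) *: (f z - f y) + (h / 2) *: (f w - f y).
  rewrite [in h *: f y](splitr h) scalerDl !scalerBr addrA !opprD.
  by rewrite [LHS]addrACA [X in X + _]addrACA.
have h2 : `|h / 2| <= t / 2 by rewrite normrM normfV [`|2|]gtr0_norm// ler_wpM2r.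
have t2 : 0 <= t / 2 by rewrite divr_ge0.
have wy : `|w - y| <= E + t * B.
  rewrite wE addrAC (le_trans (ler_normD _ _))// lerD// normrZ.
  by rewrite ler_pM// (le_trans h2)// ler_pdivrMr// ler_peMr// ler1n.
have fz' : `|(h / 2) *: (f z - f y)| <= t / 2 * (L * E).
  by rewrite normrZ ler_pM// (le_trans fz)// ler_wpM2l.
have fw' : `|(h / 2) *: (f w - f y)| <= t / 2 * (L * (E + t * B)).
  by rewrite normrZ ler_pM// (le_trans fw)// ler_wpM2l.
rewrite (le_trans (ler_normD _ _))// (le_trans (lerD (ler_normD _ _) (lexx _)))//.
rewrite (le_trans (lerD (lerD pq fz') fw'))//.
have : 0 <= t * L * (t * B) by rewrite !mulr_ge0.
lra.
Qed.

(** Induction on [k]: [half_step_le] with t = U / N has local error U L (U B) / N^2, which is the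
    term b / N of [gronwallS]. As [b] carries a factor 1 / N, the total error is O(1 / N). *)
Lemma euler_half h (N k : nat) x (r U L : R) :
  (0 < N)%N -> N%:R * `|h| <= U -> (k <= N)%N -> `|x| <= r -> 0 <= L ->
  (forall y z, `|y| <= r + U * B -> `|z| <= r + U * B ->
    `|F y - F z| <= L * `|y - z|) ->
  (forall y z, `|y| <= r + U * B -> `|z| <= r + U * B ->
    `|g y - g z| <= L * `|y - z|) ->
  let E := gronwall (U * L) (U * L * (U * B) / N%:R) N k in
  `|euler_pos (h / 2) k.*2 x - euler_pos h k x| <= E /\
  `|euler_int (h / 2) k.*2 x - euler_int h k x| <= E.
Proof.
move=> N0 NU kN xr L0 FL gL /=.
have U0 : 0 <= U by rewrite (le_trans _ NU)// mulr_ge0.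
have b0 : 0 <= U * L * (U * B) / N%:R by rewrite divr_ge0// !mulr_ge0.
have a0 : 0 <= U * L by rewrite mulr_ge0.
elim: k kN => [|k IH] kN.
  by rewrite !subrr !normr0 gronwall0.
have {IH} [IHy IHw] := IH (ltnW kN).
have E0 := gronwall_ge0 N k a0 b0.
have := gronwallS N k a0 b0.
move: IHy IHw E0; set E := gronwall _ _ _ k => IHy IHw E0 ES.
have kU m : (m <= N)%N -> m%:R * `|h| <= U.
  by move=> mN; rewrite (le_trans _ NU)// ler_wpM2r// ler_nat.
have kU2 m : (m <= N.*2)%N -> m%:R * `|h / 2| <= U.
  move=> mN; rewrite (le_trans _ NU)// normrM normfV [`|2|]gtr0_norm//.
  rewrite mulrA ler_pdivrMr// mulrAC ler_wpM2r//.
  by rewrite -natrM ler_nat muln2.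
have yb : `|euler_pos h k x| <= r + U * B.
  by apply: euler_pos_ball => //; apply: kU; exact: ltnW.
have zb m : (m <= N.*2)%N -> `|euler_pos (h / 2) m x| <= r + U * B.
  by move=> mN; apply: euler_pos_ball => //; exact: kU2.
have z0b : `|euler_pos (h / 2) k.*2 x| <= r + U * B.
  by apply: zb; rewrite leq_double ltnW.
have z1b : `|euler_pos (h / 2) k.*2.+1 x| <= r + U * B.
  by apply: zb; rewrite (leq_trans (leqnSn _))// -doubleS leq_double.
have hU : `|h| <= U / N%:R by rewrite ler_pdivlMr ?ltr0n// mulrC.
have E'E : E + U / N%:R * L * E + U / N%:R * L * (U / N%:R * B) <=
    gronwall (U * L) (U * L * (U * B) / N%:R) N k.+1.
  rewrite (le_trans _ ES)// le_eqVlt; apply/orP; left; apply/eqP.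
  congr (_ + _ + _); ring.
rewrite doubleS; split; apply: le_trans _ E'E.
  apply: (half_step_le hU L0 E0 IHy IHy) => //.
  + exact: FL.
  + exact: FL.
apply: (@half_step_le R g _ _ _ _ _ _ _ _ _ hU L0 E0 IHw IHy) => //.
+ exact: gL.
+ exact: gL.
Qed.

End euler.

(** * Derivative of the Euler scheme with a variable step *)

Section euler_derivative.
Context {R : realType} {n : nat}.
Variables (F : 'rV[R]_n -> 'rV[R]_n) (g : 'rV[R]_n -> R).
Hypothesis F1 : forall i, class_C 1 (fun x => F x ord0 i).
Hypothesis g1 : class_C 1 g.

Lemma is_derive_euler_step (f q h : 'rV[R]_n -> R) (y : 'rV[R]_n -> 'rV[R]_n)
    x v (dy : 'rV[R]_n) (dq dh : R) : class_C 1 f ->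
  is_derive x v y dy -> is_derive x v q dq -> is_derive x v h dh ->
  is_derive x v (fun z => q z + h z * f (y z))
    (dq + (h x * (\sum_j dy ord0 j * partial j f (y x)) + f (y x) * dh)).
Proof.
move=> f1 yd qd hd; apply: is_deriveD; apply: is_deriveM.
exact: is_derive_comp_C1.
Qed.

Variables (h : 'rV[R]_n -> R) (x v : 'rV[R]_n) (dh : R).
Hypothesis hd : is_derive x v h dh.

(** The recursion of [euler_pos] differentiated along [v], when the step also depends on the
    starting point, with derivative [dh]. *)
Fixpoint deuler_pos (k : nat) : 'rV[R]_n :=
  if k is k'.+1 then \row_i (deuler_pos k' ord0 i +
    (h x * (\sum_j deuler_pos k' ord0 j *
       partial j (fun z => F z ord0 i) (euler_pos F (h x) k' x)) +
     F (euler_pos F (h x) k' x) ord0 i * dh)) else v.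

Fixpoint deuler_int (k : nat) : R :=
  if k is k'.+1 then deuler_int k' +
    (h x * (\sum_j deuler_pos k' ord0 j *
       partial j g (euler_pos F (h x) k' x)) +
     g (euler_pos F (h x) k' x) * dh) else 0.

Lemma is_derive_euler_pos k :
  is_derive x v (fun z => euler_pos F (h z) k z) (deuler_pos k).
Proof.
elim: k => [|k IH] /=; first exact: is_derive_id.
apply: is_derive_rV => i; rewrite mxE; under eq_fun do rewrite !mxE.
apply: (is_derive_euler_step (F1 i) IH _ hd).
have [dy dyE] := IH; split; first by move/derivable_mxP : dy; exact.
by have := derive_mx dy; rewrite dyE => ->; rewrite mxE.
Qed.

Lemma is_derive_euler_int k :
  is_derive x v (fun z => euler_int F g (h z) k z) (deuler_int k).
Proof.
elim: k => [|k IH] /=; first exact: is_derive_cst.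
exact: (is_derive_euler_step g1 (is_derive_euler_pos k) IH hd).
Qed.

End euler_derivative.

Section euler_error.
Context {R : realType} {n : nat}.
Implicit Types (f g : 'rV[R]_n -> R) (F : 'rV[R]_n -> 'rV[R]_n).

(* Along the flow of F the step has derivative - 1 / N, and the k-th Euler
   iterate of x has derivative close to (1 - k / N) F: this is one step of the
   induction. *)
Lemma euler_error_step f (y Fy dy : 'rV[R]_n) (h U L B E e dq : R) (N k : nat) :
  (k < N)%N -> 0 <= L -> 0 <= B -> 0 <= E -> 0 <= e ->
  N%:R * `|h| <= U -> (forall j, `|partial j f y| <= L) -> `|Fy| <= B ->
  (forall j, `|dy ord0 j - (1 - k%:R / N%:R) * Fy ord0 j| <= E) ->
  `|dq - (1 - k%:R / N%:R) * f y| <= E ->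
  `|f (y + h *: Fy) - f y - \sum_j (h *: Fy) ord0 j * partial j f y| <=
    e * `|h *: Fy| ->
  `|dq + (h * (\sum_j dy ord0 j * partial j f y) + f y * - N%:R^-1) -
    (1 - k.+1%:R / N%:R) * f (y + h *: Fy)| <=
  E + U * (n%:R * L) / N%:R * E + (U * (n%:R * L) * B / N%:R + e * (U * B)) / N%:R.
Proof.
move=> kN L0 B0 E0 e0 NU fL FyB dyE dqE taylor.
have N0 : (0 < N)%N by rewrite (leq_ltn_trans _ kN).
have hU : `|h| <= U / N%:R by rewrite ler_pdivlMr ?ltr0n// mulrC.
have iN0 : 0 <= (N%:R^-1 : R) by rewrite invr_ge0.
have U0 : 0 <= U / N%:R by exact: le_trans hU.
pose S1 := \sum_j (dy ord0 j - (1 - k%:R / N%:R) * Fy ord0 j) * partial j f y.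
pose S2 := \sum_j Fy ord0 j * partial j f y.
pose rho := f (y + h *: Fy) - f y - \sum_j (h *: Fy) ord0 j * partial j f y.
have S12 : \sum_j dy ord0 j * partial j f y = S1 + (1 - k%:R / N%:R) * S2.
  rewrite /S1 /S2 mulr_sumr -big_split/=; apply: eq_bigr => j _; ring.
have hS2 : \sum_j (h *: Fy) ord0 j * partial j f y = h * S2.
  by rewrite /S2 mulr_sumr; apply: eq_bigr => j _; rewrite mxE mulrA.
have S1L : `|S1| <= n%:R * L * E.
  rewrite (le_trans (ler_norm_sum _ _ _))//.
  apply: (@le_trans _ _ (\sum_(j < n) L * E)).
    by apply: ler_sum => j _; rewrite normrM mulrC ler_pM.
  by rewrite sumr_const card_ord -[leLHS]mulr_natl mulrA.
have S2L : `|S2| <= n%:R * L * B.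
  rewrite (le_trans (ler_norm_sum _ _ _))//.
  apply: (@le_trans _ _ (\sum_(j < n) L * B)).
    apply: ler_sum => j _; rewrite normrM mulrC ler_pM//.
    exact: le_trans (ler_rV_coord _ _) FyB.
  by rewrite sumr_const card_ord -[leLHS]mulr_natl mulrA.
have rhoE : `|rho| <= e * (U / N%:R * B).
  by rewrite (le_trans taylor)// ler_wpM2l// normrZ ler_pM.
have kN1 : `|1 - k.+1%:R / N%:R : R| <= 1.
  rewrite ger0_norm; first by rewrite gerBl divr_ge0.
  by rewrite subr_ge0 ler_pdivrMr ?ltr0n// mul1r ler_nat.
(* Four contributions: the previous error on [dq], the error on [dy] carried through the gradient of
   [f], a second order term left by the change of factor from 1 - k / N to 1 - (k + 1) / N, and the
   Taylor remainder. *)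
have -> : dq + (h * (\sum_j dy ord0 j * partial j f y) + f y * - N%:R^-1) -
    (1 - k.+1%:R / N%:R) * f (y + h *: Fy) =
    (dq - (1 - k%:R / N%:R) * f y) + h * S1 + N%:R^-1 * (h * S2) -
    (1 - k.+1%:R / N%:R) * rho.
  have -> : f (y + h *: Fy) = f y + h * S2 + rho by rewrite /rho hS2; ring.
  rewrite S12 -natr1; ring.
have h1 : `|h * S1| <= U / N%:R * (n%:R * L * E) by rewrite normrM ler_pM.
have h2 : `|N%:R^-1 * (h * S2)| <= N%:R^-1 * (U / N%:R * (n%:R * L * B)).
  by rewrite normrM ger0_norm// ler_wpM2l// normrM ler_pM.
have h3 : `|(1 - k.+1%:R / N%:R) * rho| <= e * (U / N%:R * B).
  by rewrite normrM (le_trans _ rhoE)// ler_piMl.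
rewrite (le_trans (ler_normB _ _))//.
rewrite (le_trans (lerD (ler_normD _ _) (lexx _)))//.
rewrite (le_trans (lerD (lerD (ler_normD _ _) (lexx _)) (lexx _)))//.
rewrite (le_trans (lerD (lerD (lerD dqE h1) h2) h3))//.
rewrite le_eqVlt; apply/orP; left; apply/eqP; ring.
Qed.

End euler_error.

Section families.
Context {R : realType} {n : nat} (I : finType).
Implicit Types (f : I -> 'rV[R]_n -> R).

Lemma partial_taylor_fin f (r e : R) : (forall i, class_C 1 (f i)) -> 0 < e ->
  exists2 d, 0 < d & forall i x v, `|x| <= r -> `|v| <= d ->
    `|f i (x + v) - f i x - \sum_j v ord0 j * partial j (f i) x| <= e * `|v|.
Proof.
move=> f1 e0; have /choice[d dP] : forall i, exists d, 0 < d /\ forall x v,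
    `|x| <= r -> `|v| <= d ->
    `|f i (x + v) - f i x - \sum_j v ord0 j * partial j (f i) x| <= e * `|v|.
  by move=> i; have [d d0 dP] := partial_taylor r (f1 i) e0; exists d.
exists (\big[Num.min/1]_i d i).
  by apply: lt_bigmin => [|i _]; [exact: ltr01|exact: (dP i).1].
by move=> i x v xr vd; apply: (dP i).2 => //; rewrite (le_trans vd)// bigmin_le.
Qed.

Lemma lipschitz_ball_fin f (r : R) : (forall i, class_C 1 (f i)) ->
  exists2 L, 0 < L & forall i x y, `|x| <= r -> `|y| <= r ->
    `|f i x - f i y| <= L * `|x - y|.
Proof.
move=> f1; have /choice[L LP] : forall i, exists L, 0 < L /\ forall x y,
    `|x| <= r -> `|y| <= r -> `|f i x - f i y| <= L * `|x - y|.
  by move=> i; have [L L0 LP] := lipschitz_ball r (f1 i); exists L.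
exists (1 + \sum_i L i).
  by rewrite ltr_wpDr// sumr_ge0// => i _; exact: ltW (LP i).1.
move=> i x y xr yr; rewrite (le_trans ((LP i).2 x y xr yr))// ler_wpM2r//.
rewrite (bigD1 i)//= addrCA lerDl addr_ge0// sumr_ge0// => j _.
exact: ltW (LP j).1.
Qed.

End families.

(** * Approximate solutions and their limit *)

Section euler_limit.
Context {R : realType} {n : nat}.
Variables (u g : 'rV[R]_n -> R) (F : 'rV[R]_n -> 'rV[R]_n) (B : R).
Hypothesis u1 : class_C 1 u.
Hypothesis F1 : forall i, class_C 1 (fun x => F x ord0 i).
Hypothesis g1 : class_C 1 g.
Hypothesis FB : forall x, `|F x| <= B.
Hypothesis Fu : forall x, 'D_(F x) u x = 1.

Definition euler_approx (N : nat) (x : 'rV[R]_n) : R :=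
  euler_int F g (- u x / N%:R) N x.

(** The coordinates of [F] and the function [g] in one finite family, so that they share their
    constants and the step estimate. *)
Let fam (o : option 'I_n) : 'rV[R]_n -> R :=
  if o is Some i then fun x => F x ord0 i else g.

Let fam1 o : class_C 1 (fam o). Proof. by case: o. Qed.

Let B0 : 0 <= B. Proof. exact: le_trans (FB 0). Qed.

Let step_class_C1 N : class_C 1 (fun x => - u x / N%:R).
Proof.
apply: class_C1M; last exact: class_C1_cst.
under eq_fun do rewrite -mulN1r.
by apply: class_C1M => //; exact: class_C1_cst.
Qed.

Lemma euler_approx_class_C1 N : class_C 1 (euler_approx N).
Proof. exact: euler_int_class_C1. Qed.

Let step_le N x U : (0 < N)%N -> `|u x| <= U -> N%:R * `|- u x / N%:R| <= U.
Proof.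
move=> N0 uU; rewrite normrM normrN normfV mulrC -mulrA.
by rewrite [`|N%:R|]ger0_norm// mulVf ?mulr1// pnatr_eq0 -lt0n.
Qed.

Lemma euler_approx_bounded (r : R) :
  exists C, forall N x, (0 < N)%N -> `|x| <= r -> `|euler_approx N x| <= C.
Proof.
have [uc _ _] := u1; have [gc _ _] := g1.
have [U U0 uU] := continuous_bounded_ball r uc.
have [G G0 gG] := continuous_bounded_ball (r + U * B) gc.
exists (U * G) => N x N0 xr; have NU := step_le N0 (uU _ xr).
by rewrite (le_trans (euler_int_bound FB NU xr gG))// ler_wpM2r// ltW.
Qed.

(** Moving [x] along [F] shortens the remaining time at unit rate. After [k] steps the derivative of
    the position is close to (1 - k / N) F, and that of the Riemann sum, plus g (x), to (1 - k / N)
    g; at k = N both main terms vanish. *)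
Lemma derive_euler_approx (r e : R) : 0 < e ->
  exists2 N0 : nat, (0 < N0)%N & forall N x, (N0 <= N)%N -> `|x| <= r ->
    `|'D_(F x) (euler_approx N) x + g x| <= e.
Proof.
move=> e0; have [uc _ _] := u1.
have [U U0 uU] := continuous_bounded_ball r uc.
have [L L0 fL] := @continuous_bounded_ball_fin R n (option 'I_n * 'I_n)%type
  (fun p => partial p.2 (fam p.1)) (r + U * B)
  (fun p => let: And3 _ _ c := fam1 p.1 in c p.2).
pose a := U * (n%:R * L); have a0 : 0 <= a by rewrite !mulr_ge0// ltW.
pose K := expR a; have K0 : 0 < K := expR_gt0 a.
have UB : 0 <= U * B by rewrite mulr_ge0// ltW.
have e2 : 0 < e / 2 by rewrite divr_gt0.
(* Chosen so that the Taylor remainders contribute eps U B K <= e / 2; the summand 1 keeps the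
   divisor positive when [B] is 0. *)
pose eps := e / 2 / ((U * B + 1) * K).
have eps0 : 0 < eps by rewrite !divr_gt0// mulr_gt0// ltr_wpDl.
have [d d0 taylor] := partial_taylor_fin (r + U * B) fam1 eps0.
have c0 : 0 <= a * B * K / (e / 2) by rewrite divr_ge0 ?(ltW e2)// !mulr_ge0// ltW.
have c1 : 0 <= U * B / d by rewrite divr_ge0// ltW.
(* The first bound makes the second order terms at most e / 2, the second one makes each Euler step
   shorter than the radius [d] of the Taylor estimate. *)
pose N0 := (Num.bound (a * B * K / (e / 2)) + Num.bound (U * B / d)).+1.
exists N0 => // N x N0N xr.
have Npos : (0 < N)%N by exact: leq_trans N0N.
have aN : a * B / N%:R * K <= e / 2.
  rewrite mulrAC ler_pdivrMr ?ltr0n// [leRHS]mulrC -ler_pdivrMr ?divr_gt0//.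
  rewrite ltW// (lt_le_trans (archi_boundP c0))// ler_nat (leq_trans _ N0N)//.
  by rewrite /N0 leqW// leq_addr.
have dN : U / N%:R * B <= d.
  rewrite mulrAC ler_pdivrMr ?ltr0n// [leRHS]mulrC -ler_pdivrMr//.
  rewrite ltW// (lt_le_trans (archi_boundP c1))// ler_nat (leq_trans _ N0N)//.
  by rewrite /N0 leqW// leq_addl.
pose h z := - u z / N%:R.
have hd : is_derive x (F x) h (- N%:R^-1).
  have ud : derivable u x (F x) by exact/diff_derivable/class_C1_differentiable.
  have -> : h = - N%:R^-1 *: u.
    by apply/funext => z; rewrite /h fctE/= mulNr -mulrN mulrC.
  rewrite -[X in is_derive _ _ _ X]mulr1 -(Fu x).
  by apply: is_deriveZ; exact: derivableP.
have NU : N%:R * `|h x| <= U := step_le Npos (uU _ xr).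
have [_ ->] := is_derive_euler_int F1 g1 hd N.
pose b := a * B / N%:R + eps * (U * B).
have b0 : 0 <= b by rewrite addr_ge0 ?(mulr_ge0 (ltW eps0))// divr_ge0// mulr_ge0.
pose y k := euler_pos F (h x) k x.
(* The constant g (x) is added to the derivative of the Riemann sum so that its error, like that of
   the position, is 0 at k = 0. *)
have step k : (k <= N)%N ->
  (forall i, `|deuler_pos F h x (F x) (- N%:R^-1) k ord0 i -
    (1 - k%:R / N%:R) * F (y k) ord0 i| <= gronwall a b N k) /\
  `|deuler_int F g h x (F x) (- N%:R^-1) k + g x -
    (1 - k%:R / N%:R) * g (y k)| <= gronwall a b N k.
  elim: k => [_|k IH kN].
    rewrite /y/= gronwall0 mul0r subr0.
    by split => [i|]; rewrite mul1r ?add0r subrr normr0.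
  have {IH} [IHy IHw] := IH (ltnW kN).
  have yb : `|y k| <= r + U * B.
    apply: (euler_pos_ball FB _ xr).
    by rewrite (le_trans _ NU)// ler_wpM2r// ler_nat ltnW.
  have vd : `|h x *: F (y k)| <= d.
    rewrite (le_trans _ dN)// normrZ ler_pM//.
    by rewrite ler_pdivlMr ?ltr0n// mulrC.
  have es o dq := @euler_error_step R n (fam o) (y k) (F (y k))
    (deuler_pos F h x (F x) (- N%:R^-1) k) (h x) U L B (gronwall a b N k)
    eps dq N k kN (ltW L0) B0 (gronwall_ge0 N k a0 b0) (ltW eps0) NU
    (fun j => fL (o, j) (y k) yb) (FB _) IHy.
  split => [i|].
    rewrite (le_trans _ (gronwallS N k a0 b0))//.
    rewrite /= mxE; exact: (es (Some i) _ (IHy i) (taylor (Some i) _ _ yb vd)).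
  rewrite (le_trans _ (gronwallS N k a0 b0))//=.
  rewrite [X in X - _]addrAC.
  exact: (es None _ IHw (taylor None _ _ yb vd)).
have [_] := step N (leqnn N).
rewrite divff ?pnatr_eq0 -?lt0n// subrr mul0r subr0 => /le_trans; apply.
rewrite (le_trans (gronwall_le a0 b0 Npos))// /b mulrDl -/K.
rewrite (splitr e) lerD//.
have -> : eps * (U * B) * K = e / 2 * (U * B / (U * B + 1)).
  by rewrite /eps; field; rewrite !gt_eqF// ltr_wpDl.
by rewrite ler_piMr ?(ltW e2)// ler_pdivrMr ?mul1r ?lerDl// ltr_wpDl.
Qed.

(** Half of the step - u(x) / N is the step used for 2 N, so [euler_half] at k = N compares the
    two. *)
Lemma euler_approx_double x : exists2 C, 0 <= C & forall N, (0 < N)%N ->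
  `|euler_approx N.*2 x - euler_approx N x| <= C / N%:R.
Proof.
pose U := `|u x|; have U0 : 0 <= U by exact: normr_ge0.
have [L L0 fL] := lipschitz_ball_fin (`|x| + U * B) fam1.
have LL := ltW L0.
exists (U * L * (U * B) * expR (U * L)); first by rewrite !mulr_ge0 ?expR_ge0.
move=> N N0; pose h := - u x / N%:R.
have NU : N%:R * `|h| <= U := step_le N0 (lexx _).
have Lip y z : `|y| <= `|x| + U * B -> `|z| <= `|x| + U * B ->
    `|F y - F z| <= L * `|y - z|.
  move=> yb zb; apply: rV_norm_le => [|i]; first by rewrite mulr_ge0.
  by rewrite !mxE; exact: (fL (Some i)).
have [_] := euler_half FB N0 NU (leqnn N) (lexx `|x|) LL Lip (fL None).
have -> : h / 2 = - u x / N.*2%:R.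
  by rewrite /h -muln2 natrM invfM mulrA mulrAC.
move=> /le_trans; apply; rewrite [leRHS]mulrAC.
by apply: gronwall_le => //; rewrite ?divr_ge0 ?mulr_ge0.
Qed.

(** The increments between successive powers of 2 are dominated by C / 2^k, so the telescoping
    series converges. *)
Lemma euler_approx_cvg x : cvgn (fun k => euler_approx (2 ^ k) x).
Proof.
have [C C0 CP] := euler_approx_double x.
pose W k := euler_approx (2 ^ k) x.
have -> : (fun k => euler_approx (2 ^ k) x) = (fun k => W 0 + series (telescope W) k).
  by apply/funext => k; rewrite -eq_sum_telescope.
apply: is_cvgD; first exact: is_cvg_cst.
apply: normed_cvg; apply: (@series_le_cvg _ _ (geometric C 2^-1)).
- by move=> k; exact: normr_ge0.
- by move=> k; rewrite /= mulr_ge0// exprn_ge0.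
- move=> k; rewrite /= /telescope/= /W expnS mul2n (le_trans (CP _ _)) ?expn_gt0//.
  by rewrite natrX exprVn.
- by apply: is_cvg_geometric_series; rewrite gtr0_norm// invf_lt1// ltr1n.
Qed.

End euler_limit.

(** * Weak divergence *)

Section divergence.
Context {R : realType} {n : nat}.
Implicit Types (f phi : 'rV[R]_n -> R) (r : R).

Lemma bounded_off_ball f r C : 0 <= C -> (forall x, `|x| <= r -> `|f x| <= C) ->
  (forall x, r < `|x| -> f x = 0) -> forall x, `|f x| <= C.
Proof.
move=> C0 fC f0 x; have [|/f0 ->] := leP `|x| r; first exact: fC.
by rewrite normr0.
Qed.

Lemma continuous_integrable_rV f r : continuous f ->
  (forall x, r < `|x| -> f x = 0) ->
  (lebesgue_rV n).-integrable setT (EFin \o f).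
Proof.
move=> fc f0; have [C C0 fC] := continuous_bounded_ball r fc.
apply: (@integrable_rV R n f r C) => //; first exact: continuous_measurable_fun_rV.
exact: bounded_off_ball (ltW C0) fC f0.
Qed.

Lemma Rintegral_divergence (psi : 'I_n -> 'rV[R]_n -> R) r :
  (forall i, class_C 1 (psi i)) -> (forall i x, r < `|x| -> psi i x = 0) ->
  \int[lebesgue_rV n]_x (\sum_i partial i (psi i) x) = 0.
Proof.
move=> psi1 psi0; rewrite /Rintegral.
have ip i : (lebesgue_rV n).-integrable setT (EFin \o partial i (psi i)).
  have [pc pd pp] := psi1 i.
  apply: (continuous_integrable_rV (r := r)) => // x.
  exact: partial_bounded_support (psi0 i).
under eq_integral do rewrite -sumEFin.
rewrite integral_sum//= big1// => i _; have [pc pd pp] := psi1 i.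
exact: (integral_partial pc (pd i) (pp i) (psi0 i)).
Qed.

Lemma test_function_class_C1 phi : test_function phi -> class_C 1 phi.
Proof. by move=> [h _]; exact: h 1%N. Qed.

Lemma test_function_support phi : test_function phi ->
  exists2 r, 0 <= r & forall x, r < `|x| -> phi x = 0.
Proof.
move=> [_ /compact_bounded[r [_ rP]]].
exists (`|r| + 1); first by rewrite addr_ge0.
move=> x rx; apply/eqP/negPn/negP => phix.
have : `|x| <= `|r| + 1.
  apply: (rP (`|r| + 1)); last exact: subset_closure.
  by rewrite (le_lt_trans (ler_norm _))// ltrDl.
by rewrite leNgt rx.
Qed.

End divergence.

Lemma expR_le_of_norm (R : realType) (a b : R) : `|a| <= b -> `|expR a| <= expR b.
Proof.
by move=> ab; rewrite ger0_norm ?expR_ge0// ler_expR (le_trans (ler_norm _)).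
Qed.

Section weak_divergence.
Context {R : realType} {n : nat}.
Variables (u w : 'rV[R]_n -> R) (w_ : nat -> 'rV[R]_n -> R).
Hypothesis u2 : class_C 2 u.
Hypothesis w1 : forall k, class_C 1 (w_ k).
Hypothesis w_cvg : forall x, w_ k x @[k --> \oo] --> w x.
Hypothesis w_bnd : forall r, exists C, forall k x, `|x| <= r -> `|w_ k x| <= C.

Let defect k x := \sum_i partial i u x * partial i (w_ k) x +
  \sum_i partial i (partial i u) x.

Hypothesis w_defect : forall r e, 0 < e ->
  exists K, forall k x, (K <= k)%N -> `|x| <= r -> `|defect k x| <= e.

Let pu1 i : class_C 1 (partial i u). Proof. by have [_ _] := u2; exact. Qed.

(** Product rule for div (phi exp w_k grad u); its integral over R^n vanishes, which relates the
    weak pairing to the defect. *)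
Lemma divergence_defect phi k x : class_C 1 phi ->
  \sum_i partial i (fun y => expR (w_ k y) * partial i u y * phi y) x =
  expR (w_ k x) * phi x * defect k x +
  Defs.dotmx (expR (w_ k x) *: grad u x) (grad phi x).
Proof.
move=> [_ phid _].
have E i : partial i (fun y => expR (w_ k y) * partial i u y * phi y) x =
    expR (w_ k x) * phi x * (partial i u x * partial i (w_ k) x) +
    expR (w_ k x) * phi x * partial i (partial i u) x +
    expR (w_ k x) * partial i u x * partial i phi x.
  have [_ wd _] := w1 k; have [_ ud _] := pu1 i.
  have ed := is_derive_comp_expR (wd i x).
  have := is_deriveM (is_deriveM ed (derivableP (ud i x))) (derivableP (phid i x)).
  move=> [_]; rewrite /partial => ->.
  rewrite fctE /GRing.scale/=; ring.
under eq_bigr do rewrite E.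
rewrite !big_split/= -!mulr_sumr -mulrDr; congr (_ + _).
by apply: eq_bigr => i _; rewrite !mxE.
Qed.

(** The divergence theorem gives [\int f_ k = - \int h_ k]. The defect tends to 0 uniformly on a
    ball containing the support of [phi], so the right side tends to 0; the left side tends to the
    pairing for [w] by dominated convergence. *)
Lemma distr_div_limit phi : test_function phi ->
  distr_div (fun x => expR (w x) *: grad u x) phi = 0.
Proof.
move=> phit; have phi1 := test_function_class_C1 phit.
have [r r0 phi0] := test_function_support phit.
have [phic _ phip] := phi1.
(* From rank [K] on the defect is at most 1 on the ball. The sequences are shifted by [K] so that
   this bound holds for all their terms. *)
have [K KP] := w_defect r ltr01.
have [C CP] := w_bnd r.
have pphi0 i x : r < `|x| -> partial i phi x = 0 by exact: partial_bounded_support.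
have wc k : continuous (fun x => expR (w_ k x)) by have [] := class_C1_expR (w1 k).
have puc i : continuous (partial i u) by have [] := pu1 i.
pose f_ k x := Defs.dotmx (expR (w_ k x) *: grad u x) (grad phi x).
pose f x := Defs.dotmx (expR (w x) *: grad u x) (grad phi x).
pose h_ k x := expR (w_ k x) * phi x * defect k x.
have f_c k : continuous (f_ k).
  rewrite /f_ /Defs.dotmx; apply: continuous_sum => i.
  under eq_fun do rewrite !mxE.
  by apply: continuous_mul => //; exact: continuous_mul.
have h_c k : continuous (h_ k).
  apply: continuous_mul; first exact: continuous_mul.
  apply: continuous_add; apply: continuous_sum => i.
    by apply: continuous_mul => //; have [] := w1 k.
  by have [] := pu1 i.
have f_0 k x : r < `|x| -> f_ k x = 0.
  by move=> rx; rewrite /f_ /Defs.dotmx big1// => i _; rewrite !mxE pphi0 ?mulr0.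
have h_0 k x : r < `|x| -> h_ k x = 0.
  by move=> rx; rewrite /h_ phi0// mulr0 mul0r.
have intfh k : \int[lebesgue_rV n]_x f_ k x = - \int[lebesgue_rV n]_x h_ k x.
  apply/eqP; rewrite -addr_eq0 -RintegralD//; first last.
  - exact: continuous_integrable_rV (h_c k) (h_0 k).
  - exact: continuous_integrable_rV (f_c k) (f_0 k).
  rewrite -[X in _ == X](@Rintegral_divergence R n
    (fun i y => expR (w_ k y) * partial i u y * phi y) r).
  - apply/eqP; apply: eq_Rintegral => x _.
    by rewrite divergence_defect// addrC.
  - move=> i; apply: class_C1M => //; apply: class_C1M => //.
    exact: class_C1_expR.
  - by move=> i x rx; rewrite phi0// mulr0.
have [Cphi Cphi0 phiC] := continuous_bounded_ball r phic.
have [Cg Cg0 gC] := continuous_bounded_ball_fin r phip.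
have [Cu Cu0 uC] := continuous_bounded_ball_fin r puc.
have eC0 : 0 <= expR C by exact: expR_ge0.
have h_cvg : \int[lebesgue_rV n]_x h_ (k + K)%N x @[k --> \oo] --> 0.
  rewrite (_ : 0 = \int[lebesgue_rV n]_x (0 : R)); last first.
    by rewrite /Rintegral integral0.
  apply: (@cvg_Rintegral_rV R n _ _ r (expR C * Cphi * 1)) => //.
  - by move=> k; exact: continuous_measurable_fun_rV.
  - move=> k; apply: bounded_off_ball (h_0 _) => [|x xr].
      by rewrite !mulr_ge0// ltW.
    rewrite !normrM ler_pM ?mulr_ge0//; last by rewrite KP ?leq_addl.
    by rewrite ler_pM// ?phiC// expR_le_of_norm// CP.
  - by move=> k x; exact: h_0.
  - move=> x; apply/cvgrPdist_le => e e0.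
    have [xr|xr] := leP `|x| r; last first.
      by apply: nearW => k; rewrite h_0// subrr normr0 ltW.
    pose c := expR C * Cphi; have c0 : 0 < c by rewrite mulr_gt0// expR_gt0.
    have [K' K'P] := w_defect r (divr_gt0 e0 c0).
    exists K' => // k /= K'k; rewrite sub0r normrN !normrM.
    have -> : e = c * (e / c) by rewrite mulrC divfK// gt_eqF.
    rewrite ler_pM ?mulr_ge0//; last by rewrite K'P// (leq_trans K'k)// leq_addr.
    by rewrite ler_pM// ?phiC// expR_le_of_norm// CP.
have f_cvg : \int[lebesgue_rV n]_x f_ (k + K)%N x @[k --> \oo] -->
    \int[lebesgue_rV n]_x f x.
  apply: (@cvg_Rintegral_rV R n _ _ r (\sum_(i < n) expR C * Cu * Cg)) => //.
  - by move=> k; exact: continuous_measurable_fun_rV.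
  - move=> k; apply: bounded_off_ball (f_0 _) => [|x xr].
      by rewrite sumr_ge0// => i _; rewrite !mulr_ge0// ltW.
    rewrite (le_trans (ler_norm_sum _ _ _))// ler_sum// => i _.
    rewrite !mxE !normrM ler_pM ?mulr_ge0//; last exact: gC.
    by rewrite ler_pM// ?uC// expR_le_of_norm// CP.
  - by move=> k x; exact: f_0.
  - move=> x; rewrite /f_ /f /Defs.dotmx; apply: cvg_big => [|i _].
      exact: add_continuous.
    rewrite !mxE; under eq_fun do rewrite !mxE.
    apply: cvgMr_tmp; apply: cvgMr_tmp.
    apply: continuous_cvg; first exact: continuous_expR.
    by rewrite (cvg_shiftn K (fun k => w_ k x)).
rewrite /distr_div; apply/eqP; rewrite oppr_eq0; apply/eqP.
have f_cvg0 : \int[lebesgue_rV n]_x f_ (k + K)%N x @[k --> \oo] --> 0.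
  rewrite (_ : (fun k => _) = (fun k => - \int[lebesgue_rV n]_x h_ (k + K)%N x)).
    by rewrite -oppr0; apply: cvgN.
  by apply/funext => k; rewrite intfh.
exact: (cvg_unique (@Rhausdorff R) f_cvg f_cvg0).
Qed.

End weak_divergence.

(** * Realizability *)

Section periodicity.
Context {R : realType} {n : nat}.
Variables (M : 'M[R]_n) (G : 'rV[R]_n -> 'rV[R]_n).
Hypothesis perG : edge_periodic M G.

Lemma edge_periodic_int x i (z : int) : G (x + z%:~R *: row i M) = G x.
Proof.
have nat_case y k : G (y + k%:R *: row i M) = G y.
  elim: k y => [|k IH] y; first by rewrite scale0r addr0.
  by rewrite -natr1 scalerDl scale1r addrA perG.
case: z => k; first exact: nat_case.
by rewrite NegzE mulrNz scaleNr -[LHS](nat_case _ k.+1) subrK.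
Qed.

Lemma edge_periodic_lattice x (z : 'I_n -> int) :
  G (x + \sum_i (z i)%:~R *: row i M) = G x.
Proof.
elim: (index_enum _) x => [|i r IH] x; first by rewrite big_nil addr0.
by rewrite big_cons addrA IH edge_periodic_int.
Qed.

(** In the basis of the rows of [M], removing the integer parts of the coordinates of [x] leaves
    coefficients in [0, 1], hence a norm at most the sum of those of the rows. *)
Lemma edge_periodic_ball : M \in unitmx ->
  exists r, forall x, exists2 y, `|y| <= r & G y = G x.
Proof.
move=> uM; exists (\sum_i `|row i M|) => x.
pose c := x *m invmx M.
have xE : x = \sum_i c ord0 i *: row i M by rewrite -mulmx_sum_row mulmxKV.
exists (x + \sum_i (- Num.floor (c ord0 i))%:~R *: row i M); last first.
  exact: edge_periodic_lattice.
rewrite [X in X + _]xE -big_split/= (le_trans (ler_norm_sum _ _ _))// ler_sum// => i _.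
rewrite -scalerDl normrZ ler_piMl// mulrNz.
have /andP[fl fu] := Num.Theory.floor_itv (c ord0 i).
rewrite ger0_norm ?subr_ge0// lerBlDl; move: fu; rewrite intrD => /ltW.
by rewrite addrC.
Qed.

End periodicity.

(** * Construction of the conductivity *)

Section realizability.
Context {R : realType} {n : nat}.
Variables (M : 'M[R]_n) (u : 'rV[R]_n -> R).
Hypothesis uM : M \in unitmx.
Hypothesis u3 : class_C 3 u.
Hypothesis gradu_per : edge_periodic M (grad u).
Hypothesis gradu_neq0 : forall x, grad u x <> 0.

Let gradsq x := \sum_i partial i u x * partial i u x.
Let laplacian x := \sum_i partial i (partial i u) x.
Let F x : 'rV[R]_n := (gradsq x)^-1 *: grad u x.
Let g x := laplacian x * (gradsq x)^-1.

Let u1 : class_C 1 u. Proof. by do 2! apply: class_CS. Qed.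

Let pu2 i : class_C 2 (partial i u). Proof. by have [_ _] := u3; exact. Qed.

Let pu1 i : class_C 1 (partial i u). Proof. exact: class_CS. Qed.

Let gradsq_neq0 x : gradsq x != 0.
Proof.
apply/eqP => /psumr_eq0P gx; apply: (gradu_neq0 (x := x)); apply/rowP => i.
rewrite !mxE; apply/eqP; rewrite -sqrf_eq0 expr2 gx// => j _.
by rewrite -expr2 sqr_ge0.
Qed.

Let gradsqV1 : class_C 1 (fun x => (gradsq x)^-1).
Proof.
by apply: class_C1V => //; apply: class_C1_sum => i; exact: class_C1M.
Qed.

Let F1 i : class_C 1 (fun x => F x ord0 i).
Proof. by under eq_fun do rewrite !mxE; exact: class_C1M. Qed.

Let g1 : class_C 1 g.
Proof.
apply: class_C1M => //; apply: class_C1_sum => i.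
by have [_ _] := pu2 i; exact.
Qed.

(** [F] depends on [x] only through [grad u], so each of its values is attained in a fixed ball,
    where it is bounded by continuity. *)
Let F_bounded : exists B, forall x, `|F x| <= B.
Proof.
have [r rP] := edge_periodic_ball gradu_per uM.
have [B B0 FB] := continuous_bounded_ball_fin r
  (fun i => let: And3 c _ _ := F1 i in c).
exists B => x; have [y yr yx] := rP x.
have -> : F x = F y.
  rewrite /F yx; congr (_^-1 *: _); apply: eq_bigr => i _.
  by move/rowP/(_ i) : yx; rewrite !mxE => ->.
by apply: rV_norm_le => [|i]; [exact: ltW|exact: FB].
Qed.

Let derive_F f x : class_C 1 f ->
  'D_(F x) f x = (gradsq x)^-1 * \sum_i partial i u x * partial i f x.
Proof.
move=> f1; rewrite derive_partial// mulr_sumr; apply: eq_bigr => i _.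
by rewrite !mxE mulrA.
Qed.

Let derive_Fu x : 'D_(F x) u x = 1.
Proof. by rewrite derive_F// mulVf. Qed.

Lemma isotropically_realizable_grad : isotropically_realizable (grad u).
Proof.
have [B FB] := F_bounded.
pose w_ k := euler_approx u g F (2 ^ k).
pose w x := lim (w_ k x @[k --> \oo]).
have w1 k : class_C 1 (w_ k) by exact: euler_approx_class_C1.
have w_cvg x : w_ k x @[k --> \oo] --> w x by exact: (euler_approx_cvg F1 g1 FB).
have w_bnd r : exists C, forall k x, `|x| <= r -> `|w_ k x| <= C.
  have [C CP] := euler_approx_bounded u1 g1 FB r.
  by exists C => k x xr; apply: CP => //; rewrite expn_gt0.
have w_defect r e : 0 < e -> exists K, forall k x, (K <= k)%N -> `|x| <= r ->
    `|\sum_i partial i u x * partial i (w_ k) x + laplacian x| <= e.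
  move=> e0; have qc : continuous gradsq.
    apply: continuous_sum => i; have [c _ _] := pu1 i.
    exact: continuous_mul.
  have [Q Q0 qQ] := continuous_bounded_ball r qc.
  have [K K0 KP] := derive_euler_approx u1 F1 g1 FB derive_Fu r (divr_gt0 e0 Q0).
  exists K => k x Kk xr.
  (* Multiplying F . grad w_k + g by |grad u|^2 restores the defect, and |grad u|^2 is at most [Q]
     on the ball. *)
  have -> : \sum_i partial i u x * partial i (w_ k) x + laplacian x =
      gradsq x * ('D_(F x) (w_ k) x + g x).
    by rewrite derive_F// /g; field; exact: gradsq_neq0.
  rewrite normrM (_ : e = Q * (e / Q)); last by rewrite mulrC divfK// gt_eqF.
  (* The number of Euler steps is 2^k > k >= K. *)
  rewrite ler_pM// ?qQ// KP// (leq_trans Kk)// ltnW// ltn_expl//.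
exists (fun x => expR (w x)); split.
- split.
    (* The conductivity is measurable as a pointwise limit of continuous functions. *)
    apply: (measurable_fun_cvg (h := fun k x => expR (w_ k x))) => [k|x _].
      by apply: continuous_measurable_fun_rV; have [] := class_C1_expR (w1 k).
    by apply: continuous_cvg; [exact: continuous_expR|exact: w_cvg].
  move=> K /compact_bounded[r [_ rP]].
  have [C CP] := w_bnd (`|r| + 1).
  exists (expR C); apply: aeW => x Kx.
  have xr : `|x| <= `|r| + 1.
    by apply: (rP (`|r| + 1)) => //; rewrite (le_lt_trans (ler_norm _))// ltrDl.
  rewrite ger0_norm ?expR_ge0// ler_expR.
  (* The bound on the ball is uniform in [k], so it passes to the limit. *)
  apply: (cvgr_to_le (w_cvg x)); apply: nearW => k.
  by rewrite (le_trans (ler_norm _))// CP.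
- by move=> x; exact: expR_gt0.
- move=> phi phit; apply: (distr_div_limit (w_ := w_)) => //.
  exact: class_CS.
Qed.

End realizability.

Theorem theorem2p14 (R : realType) (d : nat) (hd : (2 <= d)%N)
  (a : 'rV[R]_d) (M : 'M[R]_d) (hM : M \in unitmx)
  (u : 'rV[R]_d -> R) (hu : class_C 3 u)
  (hper : edge_periodic M (grad u))
  (havg : average (parallelepiped a M) (grad u) <> 0)
  (hgrad : forall x, grad u x <> 0) :
  isotropically_realizable (grad u).
Proof. exact: isotropically_realizable_grad hM hu hper hgrad. Qed.
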